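(* Let $n \geqslant 25$ be an integer and let $G$ be a plane graph on $n$ vertices that contains neither $K_4$ nor $\Theta_5$ as a subgraph. Then $$e(G) \leqslant \frac{25}{11}(n-2),$$ where $e(G)$ denotes the number of edges of $G$.
   Context: Graphs are simple. $\Theta_5$ denotes the (unique up to isomorphism) Theta graph on $5$ vertices: the graph obtained from a cycle $C_5$ by adding one edge joining two non-consecutive vertices of the cycle. A graph is $\{K_4,\Theta_5\}$-free if it contains no subgraph (not necessarily induced) isomorphic to $K_4$ or to $\Theta_5$. *)

(* Defs.v *)
From mathcomp Require Import all_boot all_order all_algebra.
From mathcomp Require Import all_classical all_reals all_analysis.
Import numFieldNormedType.Exports.

Set Implicit Arguments.
Unset Strict Implicit.
Unset Printing Implicit Defensive.

Record sgraph := SGraph {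
  vertex :> finType;
  adj : rel vertex;
  adj_sym : symmetric adj;
  adj_irr : irreflexive adj
}.

Definition edges (G : sgraph) : {set {set G}} :=
  [set E : {set G} | [exists x : G, [exists y : G,
    adj x y && (E == [set x; y]%SET)]]]%SET.

(* [H] is isomorphic to a (not necessarily induced) subgraph of [G]. *)
Definition contains (G H : sgraph) : Prop :=
  exists f : H -> G,
    injective f /\ (forall x y : H, adj x y -> adj (f x) (f y)).

Definition K4_adj : rel 'I_4 := fun i j => i != j.

Lemma K4_adj_sym : symmetric K4_adj.
Proof. by move=> i j; rewrite /K4_adj eq_sym. Qed.

Lemma K4_adj_irr : irreflexive K4_adj.
Proof. by move=> i; rewrite /K4_adj eqxx. Qed.

Definition K4 : sgraph := SGraph K4_adj_sym K4_adj_irr.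

(* The 5-cycle 0, 1, 2, 3, 4 with the chord {0, 2}. *)
Definition Theta5_adj : rel 'I_5 := fun i j =>
  [|| j == i.+1 %[mod 5], i == j.+1 %[mod 5],
      (i == 0 :> nat) && (j == 2 :> nat) |
      (i == 2 :> nat) && (j == 0 :> nat)].

Lemma Theta5_adj_sym : symmetric Theta5_adj.
Proof. by do 2!case=> [[|[|[|[|[|?]]]]] ?]. Qed.

Lemma Theta5_adj_irr : irreflexive Theta5_adj.
Proof. by case=> [[|[|[|[|[|?]]]]] ?]. Qed.

Definition Theta5 : sgraph := SGraph Theta5_adj_sym Theta5_adj_irr.

Local Open Scope ring_scope.

Definition simple_arc (R : realType) (g : R -> R * R) : Prop :=
  {within `[0, 1], continuous g}%classic /\
  (forall s t : R, 0 <= s <= 1 -> 0 <= t <= 1 -> g s = g t -> s = t).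

(* The fields say that the drawing has no crossing. Edges are unordered pairs,
   so [edge_arc] is indexed by sets and picks one orientation of each edge; its
   values on non-edges, or outside [0, 1], are irrelevant. *)
Record plane_graph (R : realType) := PlaneGraph {
  pg_graph :> sgraph;
  vertex_point : pg_graph -> R * R;
  edge_arc : {set pg_graph} -> R -> R * R;
  vertex_point_inj : injective vertex_point;
  edge_arc_simple : forall E, E \in edges pg_graph -> simple_arc (edge_arc E);
  edge_arc_ends : forall E, E \in edges pg_graph ->
    exists x y : pg_graph,
      [/\ E = [set x; y]%SET, edge_arc E 0 = vertex_point x
        & edge_arc E 1 = vertex_point y];
  edge_arc_vertex : forall E, E \in edges pg_graph ->
    forall (t : R) (x : pg_graph), 0 < t < 1 -> edge_arc E t <> vertex_point x;
  edge_arc_disjoint : forall E F,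
    E \in edges pg_graph -> F \in edges pg_graph ->
    E != F -> forall s t : R, 0 < s < 1 -> 0 <= t <= 1 ->
    edge_arc E s <> edge_arc F t
}.

(* Main.v *)
(* The drawing is discretised. On a sufficiently fine square grid, a box around
   each vertex, enlarged by the part of each grid path following an edge up to
   the box around its other end, gives disjoint connected sets, so G is a minor
   of the grid. Contracting and deleting edges preserves the structure
   [plane_map] of the grid: a set of faces, two at each edge, whose boundaries
   are even mod 2, which is connected in the dual and satisfies
   e + 2 <= n + f. This weak form of Euler's formula is all that is used of
   planarity, so no Jordan curve theorem is needed.

   The bound amounts to 25 f <= 14 e. Each edge has 28 units to share between its
   two faces, and each face is shown to collect at least 50. As G is
   {K4, Theta5}-free, a triangular face has at most one edge in common with
   another triangular face, and a quadrangular face that meets a triangular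
   face shares exactly two edges with it. Hence short faces border enough long
   ones to take more than half of the units of the edges in between. *)
Require Import Defs.
From mathcomp Require Import all_boot all_order all_algebra.
From mathcomp Require Import zify lra boolp.

Set Implicit Arguments.
Unset Strict Implicit.
Unset Printing Implicit Defensive.

(** * Plane maps and their minors *)

Section PlaneMaps.
Variables (V E F : finType).

(* Cuts and dual cuts meet evenly: for [P] and [S] singletons this says that
   every face boundary is an even edge set, and it passes to quotients of [V]
   and [F] by composition. *)
Definition plane_map (s t : E -> V) (l r : E -> F) (A : {set E}) : Prop :=
  [/\ forall (P : V -> bool) (S : F -> bool),
        \big[addb/false]_(e in A)
          ((P (s e) (+) P (t e)) && (S (l e) (+) S (r e))) = false,
      #|A| + 2 <= #|V| + #|F| &
      forall S : F -> bool, (forall e, e \in A -> S (l e) = S (r e)) ->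
        forall f g, S f = S g].
End PlaneMaps.

(** Each edge of [T] is contracted in turn, and each contraction loses at most one value of [k].
    This counts components, of vertices and also of faces in the dual. *)
Lemma merge_ends (V E : finType) (s t : E -> V) (T : seq E) :
  exists k : V -> V, (forall e, e \in T -> k (s e) = k (t e)) /\
    #|V| <= #|codom k| + size T.
Proof.
elim: T => [|e T [k [kT kc]]].
  exists id; split=> //=; rewrite addn0.
  rewrite -[X in X <= _](card_codom (@inj_id V)) //.
pose m x := if x == k (t e) then k (s e) else x.
exists (m \o k); split=> [d|/=].
  rewrite inE => /predU1P[->|/kT /= -> //]; rewrite /m /= eqxx.
  by case: ifP => // /eqP ->.
apply: leq_trans kc _; rewrite addnS -addSn leq_add2r.
have sub : {subset codom k <= k (t e) :: codom (m \o k)}.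
  move=> y /codomP[x ->]; rewrite inE.
  have [//|ne /=] := eqVneq; apply/codomP; exists x.
  by rewrite /= /m (negPf ne).
apply: leq_trans (subset_leq_card (introT subsetP sub)) _.
by rewrite cardU1; case: (_ \notin _).
Qed.

(** Edges outside [C] are dropped one at a time as long as the dual stays connected. *)
Lemma minimal_conn (E F : finType) (l r : E -> F) (A C : {set E}) :
  let conn (B : {set E}) := forall S : F -> bool,
    (forall e, e \in B -> S (l e) = S (r e)) -> forall f g, S f = S g in
  C \subset A -> conn A -> exists B : {set E},
    [/\ C \subset B, B \subset A, conn B &
        forall e, e \in B -> e \notin C -> ~ conn (B :\ e)].
Proof.
move=> conn; have [n] := ubnP #|A|; elim: n A => // n IH A ltn CA cA.
case: (EM (exists e, [/\ e \in A, e \notin C & conn (A :\ e)])); last first.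
  by move=> no; exists A; split=> // e eA eC ce; apply: no; exists e.
move=> [e [eA eC ce]].
have [||//|B [CB BA cB mB]] := IH (A :\ e).
- by rewrite [X in X < _](cardsD1 e) eA in ltn.
- by rewrite subsetD1 CA eC.
by exists B; split=> //; apply: subset_trans BA (subsetDl _ _).
Qed.

Section Minor.
Variables (V W E F : finType) (s t : E -> V) (l r : E -> F) (A B : {set E}).
Variable lam : V -> W.
Hypothesis mapA : plane_map s t l r A.
Hypothesis lam_surj : forall w, exists v, lam v = w.
Hypothesis lam_conn : forall P : V -> bool,
  (forall e, e \in A -> lam (s e) = lam (t e) -> P (s e) = P (t e)) ->
  forall x y, lam x = lam y -> P x = P y.

(* Let D be a minimal dual-connected set containing the edges that are not
   collapsed. The other edges connect the fibres: otherwise a cut avoiding them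
   would meet, in a single edge of D, a dual cut provided by minimality. There
   are thus at least |V| - |W| of them. *)
Lemma contract_fibres : exists D : {set E},
  [/\ D \subset A, forall e, e \in A -> lam (s e) <> lam (t e) -> e \in D
    & plane_map (lam \o s) (lam \o t) l r D].
Proof.
case: mapA => orth euler conn.
pose C := [set e in A | lam (s e) != lam (t e)].
have CA : C \subset A by apply/subsetP=> e; rewrite inE => /andP[].
have [D [CD DA cD mD]] := minimal_conn CA conn.
have DC e : e \in A -> lam (s e) <> lam (t e) -> e \in D.
  by move=> eA /eqP ne; rewrite (subsetP CD) // inE eA.
exists D; split=> //; split=> //.
  move=> P S; rewrite -[RHS](orth (P \o lam) S) [RHS](big_setID D) /= (setIidPr DA).
  rewrite [X in _ = _ (+) X]big1 ?addbF // => e; rewrite inE => /andP[eD eA].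
  have [->|/eqP/(DC _ eA)] := eqVneq (lam (s e)) (lam (t e)); first by rewrite addbb.
  by rewrite (negPf eD).
have AD_conn (P : V -> bool) :
    (forall e, e \in A :\: D -> P (s e) = P (t e)) ->
    forall x y, lam x = lam y -> P x = P y.
  move=> PA; apply: lam_conn => e eA le; apply/eqP/negPn/negP => Pne.
  have eD : e \in D by apply: contraR Pne => eD; rewrite PA // inE eD.
  have eC : e \notin C by rewrite inE le eqxx andbF.
  apply: (mD e eD eC) => S Sl f g; have [fg|] := eqVneq (S f) (S g); first by [].
  (* A set [S] that is constant along [D :\ e] but not overall must change across [e]. In [orth P S]
     the other edges of [D] vanish through [S] and those outside [D] through [P], so [e] alone is
     counted. *)
  move=> fg; have Se : S (l e) != S (r e).
    apply: contraNneq fg => Se; apply/eqP; apply: cD => d dD.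
    by have [->//|de] := eqVneq d e; apply: Sl; rewrite !inE de.
  have := orth P S; rewrite (bigD1 e) //= big1 => [|d /andP[dA de]].
    by move: Pne Se; case: (P _); case: (P _); case: (S _); case: (S _).
  have [dD|dD] := boolP (d \in D).
    by rewrite (Sl d) ?addbb ?andbF // !inE de.
  by rewrite PA ?addbb // inE dD.
have [k [kAD kc]] := merge_ends s t (enum (A :\: D)).
rewrite -cardE in kc.
(* [k] is constant on fibres, hence has at most |W| values; with [kc] this bounds [#|A :\: D|] from
   below. *)
have kW : #|codom k| <= #|W|.
  have kl x y : lam x = lam y -> k x = k y.
    move=> xy; have := @AD_conn (fun z => k z == k x) _ x y xy.
    by rewrite eqxx => /(_ _)/esym/eqP -> // e eAD; rewrite kAD ?mem_enum.
  have [inv invK] : exists inv : W -> V, forall w, lam (inv w) = w.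
    exact: (fin_all_exists lam_surj).
  have sub : {subset codom k <= codom (k \o inv)}.
    move=> y /codomP[x ->]; apply/codomP; exists (lam x).
    by apply: kl; rewrite invK.
  apply: leq_trans (subset_leq_card (introT subsetP sub)) _.
  by apply: leq_trans (card_size _) _; rewrite size_codom.
have := cardsD A D; rewrite (setIidPr DA).
have := subset_leq_card DA; lia.
Qed.
End Minor.

(** Deleting an edge merges its two faces, so at most one face is lost per edge and the Euler
    inequality survives. The new faces are the values of the merging map [k]. *)
Lemma delete_edges (W E F : finType) (s t : E -> W) (l r : E -> F)
    (D B : {set E}) :
  plane_map s t l r D -> B \subset D ->
  exists (F' : finType) (l' r' : E -> F'), plane_map s t l' r' B.
Proof.
move=> [orth euler conn] BD.
have [k [kDB kc]] := merge_ends l r (enum (D :\: B)); rewrite -cardE in kc.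
have kP e : k e \in codom k by apply: codom_f.
pose c e : {x | x \in codom k} := Sub (k e) (kP e).
have cDB e : e \in D :\: B -> c (l e) = c (r e).
  by move=> eDB; apply: val_inj; rewrite /= kDB ?mem_enum.
exists {x | x \in codom k}, (c \o l), (c \o r); split.
- move=> P S; rewrite -[RHS](orth P (S \o c)) [RHS](big_setID B) /= (setIidPr BD).
  by rewrite [X in _ = _ (+) X]big1 ?addbF // => e /cDB ->; rewrite addbb andbF.
- have := cardsD D B; rewrite (setIidPr BD) card_sig.
  have -> : #|[pred x | x \in codom k]| = #|codom k| by apply: eq_card.
  have := subset_leq_card BD; lia.
move=> S Sc; have cs x : exists y, x = c y.
  by case/codomP: (valP x) => y xy; exists y; apply: val_inj.
have Sk : forall f g, S (c f) = S (c g).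
  apply: (conn (S \o c)) => e eD /=.
  by have [/Sc//|eB] := boolP (e \in B); rewrite cDB // inE eB.
by move=> f g; have [x ->] := cs f; have [y ->] := cs g.
Qed.

Lemma minor_plane_map (V W E F : finType) (s t : E -> V) (l r : E -> F)
    (A B : {set E}) (lam : V -> W) :
  plane_map s t l r A -> (forall w, exists v, lam v = w) ->
  (forall P : V -> bool,
    (forall e, e \in A -> lam (s e) = lam (t e) -> P (s e) = P (t e)) ->
    forall x y, lam x = lam y -> P x = P y) ->
  B \subset A -> (forall e, e \in B -> lam (s e) <> lam (t e)) ->
  exists (F' : finType) (l' r' : E -> F'),
    plane_map (lam \o s) (lam \o t) l' r' B.
Proof.
move=> mapA sur conn BA Bne; have [D [DA DC mapD]] := contract_fibres mapA sur conn.
apply: (delete_edges mapD); apply/subsetP=> e eB.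
by apply: DC; [apply: (subsetP BA) | apply: Bne].
Qed.

(** An unlabelled vertex next to a labelled one takes over its label; connectedness supplies such a
    vertex until none is left. Connected classes are expressed by two-valued functions constant
    along inner edges. *)
Lemma extend_labelling (V W E : finType) (s t : E -> V) (lam : V -> option W) :
  (forall P : V -> bool, (forall e, P (s e) = P (t e)) -> forall x y, P x = P y) ->
  (exists x, lam x) ->
  (forall P : V -> bool,
    (forall e, lam (s e) -> lam (s e) = lam (t e) -> P (s e) = P (t e)) ->
    forall x y, lam x -> lam x = lam y -> P x = P y) ->
  exists lam' : V -> W,
    (forall x w, lam x = Some w -> lam' x = w) /\
    forall P : V -> bool,
    (forall e, lam' (s e) = lam' (t e) -> P (s e) = P (t e)) ->
    forall x y, lam' x = lam' y -> P x = P y.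
Proof.
move=> conn; have [n] := ubnP #|[pred x | ~~ lam x]|.
elim: n lam => // n IH lam ltn [x0 lx0] lconn.
case: (pickP [pred x | ~~ lam x]) => [b /= lb|all]; last first.
  have lT x : lam x by have /= /negbFE := all x.
  have [w0 _] : exists w0, lam x0 = Some w0.
    by case: (lam x0) lx0 => // w _; exists w.
  exists (fun x => odflt w0 (lam x)); split=> [x w -> //|P Pe x y xy].
  have lE u v : odflt w0 (lam u) = odflt w0 (lam v) -> lam u = lam v.
    by have := lT u; have := lT v; case: (lam u) (lam v) => [?|//] [?|//] /= _ _ ->.
  by apply: lconn => // [e _ le|]; [apply: Pe; rewrite le | apply: lE].
have [e Pe] : exists e, lam (s e) != lam (t e) :> bool.
  apply: contrapT => no; have := conn (fun x => lam x : bool) _ x0 b.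
  suff Pc : forall e, lam (s e) = lam (t e) :> bool by rewrite lx0 (negPf lb) => /(_ Pc).
  by move=> e; apply/eqP/negPn/negP=> ne; apply: no; exists e.
(* The edge found may point either way. The last clause makes the edge condition usable between its
   labelled end [a] and its unlabelled end [c] in both cases. *)
have [a [c [la lc ac]]] : exists a c, [/\ lam a, ~~ lam c &
    forall (lam' : V -> option W) (P : V -> bool),
    (forall e, lam' (s e) -> lam' (s e) = lam' (t e) -> P (s e) = P (t e)) ->
    lam' a -> lam' a = lam' c -> P a = P c].
  have [ls|ls] := boolP (lam (s e) : bool).
    exists (s e), (t e); split=> //; last by move=> ? ? H ? ?; apply: H.
    by move: Pe; rewrite ls; case: (lam (t e)).
  exists (t e), (s e); split=> //; first by move: Pe; rewrite (negPf ls); case: (lam (t e)).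
  by move=> ? ? H ? eq; apply/esym/H => //; rewrite -eq.
pose lam1 x := if x == c then lam a else lam x.
have l1 x : lam x -> lam1 x = lam x.
  by rewrite /lam1; case: eqP lc => // <- /negPf ->.
have l1ca : lam1 c = lam1 a by rewrite /lam1 eqxx if_same.
have [||P Pe' x y|lam' [ext conn']] := IH lam1.
- move: ltn; rewrite (cardD1 c) inE lc add1n ltnS; apply: leq_trans.
  rewrite ltnS; apply: subset_leq_card; apply/subsetP=> x; rewrite !inE /lam1.
  by case: eqVneq => // _; rewrite la.
- by exists x0; rewrite l1.
- have PE : P a = P c by apply: (ac lam1) => //; rewrite l1.
  have Pl : forall x y, lam x -> lam x = lam y -> P x = P y.
    apply: lconn => d ld eqd; apply: Pe'; first by rewrite l1.
    by rewrite !l1 // -eqd.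
  (* Redirecting [c] to [a] changes neither [P] nor the new label, which reduces the claim to the
     old classes. *)
  pose q z := if z == c then a else z.
  have Pq z : P (q z) = P z by rewrite /q; case: eqP => // ->.
  have lq z : lam1 z = lam (q z) by rewrite /lam1 /q; case: ifP.
  by rewrite !lq -(Pq x) -(Pq y); apply: Pl.
exists lam'; split=> // x w lx; apply: ext.
by rewrite l1 lx.
Qed.

(** * The square grid *)

Section Grid.
Variable M : nat.

Definition grid_vertex : finType := ('I_M.+1 * 'I_M.+1)%type.
Definition grid_edge : finType := ('I_M * 'I_M.+1 + 'I_M.+1 * 'I_M)%type.
Definition grid_face : finType := option ('I_M * 'I_M).

Definition grid_src (e : grid_edge) : grid_vertex :=
  match e with inl c => (lift ord_max c.1, c.2) | inr c => (c.1, lift ord_max c.2) end.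
Definition grid_tgt (e : grid_edge) : grid_vertex :=
  match e with inl c => (lift ord0 c.1, c.2) | inr c => (c.1, lift ord0 c.2) end.
(** [None] is the outer face: [unlift] yields it exactly for border edges with no cell on that
    side. *)
Definition grid_left (e : grid_edge) : grid_face :=
  match e with
  | inl c => omap (pair c.1) (unlift ord_max c.2)
  | inr c => omap (pair^~ c.2) (unlift ord0 c.1)
  end.
Definition grid_right (e : grid_edge) : grid_face :=
  match e with
  | inl c => omap (pair c.1) (unlift ord0 c.2)
  | inr c => omap (pair^~ c.2) (unlift ord_max c.1)
  end.

Lemma xor_unlift (h : 'I_M.+1) (f : 'I_M.+1 -> bool) (g : option 'I_M -> bool) :
  g None = false ->
  \big[addb/false]_j (f j && g (unlift h j)) =
  \big[addb/false]_j (f (lift h j) && g (Some j)).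
Proof.
move=> g0; rewrite (bigD1_ord h) //= unlift_none g0 andbF addFb.
by apply: eq_bigr => j _; rewrite liftK.
Qed.

(** Sorted by cells, the sum gives each cell in [S] the differences of [P] along its four sides, and
    these cancel around the cell. *)
Lemma grid_orth (P : grid_vertex -> bool) (S : grid_face -> bool) :
  \big[addb/false]_(e : grid_edge) ((P (grid_src e) (+) P (grid_tgt e)) &&
    (S (grid_left e) (+) S (grid_right e))) = false.
Proof.
(* Adding a constant to [S] keeps all differences, so the outer face may be left out of the sum. *)
wlog S0 : S / S None = false.
  move=> /(_ (fun x => S x (+) S None)); rewrite addbb => /(_ erefl) H; rewrite -[RHS]H.
  by apply: eq_bigr => e _; congr andb; case: (S _) (S _) (S None) => [] [] [].
rewrite big_sumType /=.
under eq_bigr => e _ do rewrite andb_addr.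
under [X in _ (+) X]eq_bigr => e _ do rewrite andb_addr.
rewrite !big_split /=.
pose p (i j : 'I_M.+1) := P (i, j).
have HL (h : 'I_M.+1) : \big[addb/false]_(e : 'I_M * 'I_M.+1)
   ((P (grid_src (inl e)) (+) P (grid_tgt (inl e))) &&
     S (omap (pair e.1) (unlift h e.2))) =
   \big[addb/false]_(c : 'I_M * 'I_M) ((p (lift ord_max c.1) (lift h c.2) (+)
      p (lift ord0 c.1) (lift h c.2)) && S (Some (c.1, c.2))).
  rewrite /= -(pair_bigA _ (fun i j => (P (lift ord_max i, j) (+) P (lift ord0 i, j)) &&
     S (omap (pair i) (unlift h j)))) /=.
  apply: etrans (pair_bigA _ (fun i j : 'I_M => (p (lift ord_max i) (lift h j) (+)
      p (lift ord0 i) (lift h j)) && S (Some (i, j)))).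
  apply: eq_bigr => i _.
  exact: (xor_unlift h (fun j => p (lift ord_max i) j (+) p (lift ord0 i) j)
    (g := fun o => S (omap (pair i) o))).
have HR (h : 'I_M.+1) : \big[addb/false]_(e : 'I_M.+1 * 'I_M)
   ((P (grid_src (inr e)) (+) P (grid_tgt (inr e))) &&
     S (omap (pair^~ e.2) (unlift h e.1))) =
   \big[addb/false]_(c : 'I_M * 'I_M) ((p (lift h c.1) (lift ord_max c.2) (+)
      p (lift h c.1) (lift ord0 c.2)) && S (Some (c.1, c.2))).
  rewrite /= -(pair_bigA _ (fun i j => (P (i, lift ord_max j) (+) P (i, lift ord0 j)) &&
     S (omap (pair^~ j) (unlift h i)))) /=.
  apply: etrans (pair_bigA _ (fun i j : 'I_M => (p (lift h i) (lift ord_max j) (+)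
      p (lift h i) (lift ord0 j)) && S (Some (i, j)))).
  rewrite [LHS]exchange_big [RHS]exchange_big /=.
  apply: eq_bigr => j _.
  exact: (xor_unlift h (fun i => p i (lift ord_max j) (+) p i (lift ord0 j))
    (g := fun o => S (omap (pair^~ j) o))).
have E1 := HL ord_max; have E2 := HL ord0; have E3 := HR ord_max; have E4 := HR ord0.
transitivity (\big[addb/false]_(c : 'I_M * 'I_M) ((p (lift ord_max c.1) (lift ord_max c.2) (+)
      p (lift ord0 c.1) (lift ord_max c.2)) && S (Some (c.1, c.2))) (+)
   \big[addb/false]_(c : 'I_M * 'I_M) ((p (lift ord_max c.1) (lift ord0 c.2) (+)
      p (lift ord0 c.1) (lift ord0 c.2)) && S (Some (c.1, c.2))) (+)
  (\big[addb/false]_(c : 'I_M * 'I_M) ((p (lift ord0 c.1) (lift ord_max c.2) (+)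
      p (lift ord0 c.1) (lift ord0 c.2)) && S (Some (c.1, c.2))) (+)
   \big[addb/false]_(c : 'I_M * 'I_M) ((p (lift ord_max c.1) (lift ord_max c.2) (+)
      p (lift ord_max c.1) (lift ord0 c.2)) && S (Some (c.1, c.2))))).
  rewrite -E1 -E2 -E3 -E4; congr (_ (+) _ (+) (_ (+) _));
    by apply: eq_bigr => -[i j] _.
rewrite -!big_split big1 //= => c _.
by rewrite -!andb_addl; case: (p _ _) (p _ _) (p _ _) (p _ _) => [] [] [] [].
Qed.

Lemma grid_conn (S : grid_vertex -> bool) :
  (forall e, S (grid_src e) = S (grid_tgt e)) -> forall x y, S x = S y.
Proof.
move=> Se; suff S0 x : S x = S (ord0, ord0) by move=> x y; rewrite !S0.
have H1 n (hn : n < M.+1) j : S (Ordinal hn, j) = S (ord0, j).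
  elim: n hn => [|n IH] hn; first by congr (S (_, _)); apply: val_inj.
  have hn' : n < M by [].
  rewrite -(IH (ltnW hn)); symmetry.
  have := Se (inl (Ordinal hn', j)); rewrite /=.
  by congr (S (_, _) = S (_, _)); apply: val_inj; rewrite //= /bump leqNgt hn'.
have H2 n (hn : n < M.+1) i : S (i, Ordinal hn) = S (i, ord0).
  elim: n hn => [|n IH] hn; first by congr (S (_, _)); apply: val_inj.
  have hn' : n < M by [].
  rewrite -(IH (ltnW hn)); symmetry.
  have := Se (inr (i, Ordinal hn')); rewrite /=.
  by congr (S (_, _) = S (_, _)); apply: val_inj; rewrite //= /bump leqNgt hn'.
by case: x => [[i hi] [j hj]]; rewrite H1 H2.
Qed.

Lemma grid_plane_map :
  plane_map grid_src grid_tgt grid_left grid_right [set: grid_edge].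
Proof.
split.
- by move=> P S; rewrite -[RHS](grid_orth P S); apply: eq_bigl => e; rewrite inE.
(* Equality holds here: both sides are 2M(M+1) + 2. *)
- rewrite cardsT card_sum !card_prod card_option card_prod !card_ord; nia.
(* Lowering the first coordinate leads from any cell to the outer face. *)
move=> S Se; suff S0 x : S x = S None by move=> x y; rewrite !S0.
case: x => [[[i hi] j]|//]; elim: i hi => [|n IH] hi.
  have := Se (inr (ord0, j)) (in_setT _); rewrite /= unlift_none.
  have -> : ord0 = lift ord_max (Ordinal hi) :> 'I_M.+1.
    by apply: val_inj; rewrite /= /bump [M <= _]leqNgt hi.
  by rewrite liftK.
rewrite -(IH (ltnW hi)).
have := Se (inr (lift ord0 (Ordinal (ltnW hi)), j)) (in_setT _).
rewrite /= liftK => /= ->.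
have -> : lift ord0 (Ordinal (ltnW hi)) = lift ord_max (Ordinal hi) :> 'I_M.+1.
  by apply: val_inj; rewrite /= /bump [M <= _]leqNgt hi.
by rewrite liftK.
Qed.
End Grid.

(** * Discharging *)

(** With boundaries listed explicitly, this reduces parity of coverage by several faces to a case
    check on equalities. *)
Lemma mem_xor (T : eqType) (q : seq T) x : uniq q ->
  (x \in q) = \big[addb/false]_(y <- q) (x == y).
Proof.
elim: q => [|y q IH]; first by rewrite big_nil.
rewrite big_cons inE => /= /andP[yq uq]; rewrite -IH //.
by case: eqP => // ->; rewrite (negPf yq).
Qed.

Section Discharging.
Variables (V E F : finType) (adj : rel V) (s t : E -> V) (l r : E -> F).
Variable B : {set E}.
Hypothesis adj_sym : symmetric adj.
Hypothesis adj_irr : irreflexive adj.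
Hypothesis noK4 : forall x y z w, adj x y -> adj x z -> adj x w ->
  adj y z -> adj y w -> adj z w -> False.
Hypothesis noTheta5 : forall a b c d e, uniq [:: a; b; c; d; e] ->
  adj a b -> adj b c -> adj c d -> adj d e -> adj e a -> adj a c -> False.
Hypothesis mapB : plane_map s t l r B.
Hypothesis B_adj : forall e, e \in B -> adj (s e) (t e).

Definition joins e x y := [|| (s e == x) && (t e == y) | (s e == y) && (t e == x)].

Hypothesis simple : forall e e' x y, e \in B -> e' \in B ->
  joins e x y -> joins e' x y -> e = e'.

Lemma joinsC e x y : joins e x y = joins e y x.
Proof. by rewrite /joins orbC. Qed.

Lemma joins_adj e x y : e \in B -> joins e x y -> adj x y.
Proof.
by move=> /B_adj ae /orP[] /andP[/eqP <- /eqP <-] //; rewrite adj_sym.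
Qed.

Lemma adj_neq x y : adj x y -> x != y.
Proof. by apply: contraTneq => ->; rewrite adj_irr. Qed.

Lemma joins_incid e x y v : joins e x y ->
  (s e == v) (+) (t e == v) = (x == v) (+) (y == v).
Proof. by move=> /orP[] /andP[/eqP -> /eqP ->] //; rewrite addbC. Qed.

(** * Small elements of the cycle space *)

Definition even_set (X : {set E}) :=
  forall v, \big[addb/false]_(e in X) ((s e == v) (+) (t e == v)) = false.

Definition tri (X : {set E}) e1 e2 e3 x y z :=
  [/\ X =i [:: e1; e2; e3], uniq [:: e1; e2; e3],
      joins e1 x y, joins e2 y z & joins e3 z x].

Definition quad (X : {set E}) e1 e2 e3 e4 x y z w :=
  [/\ X =i [:: e1; e2; e3; e4], uniq [:: e1; e2; e3; e4], uniq [:: x; y; z; w] &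
      [/\ joins e1 x y, joins e2 y z, joins e3 z w & joins e4 w x]].

(** Even degree at [y] provides a second edge there, and simplicity keeps it from returning to
    [x]. *)
Lemma even_next (X : {set E}) e x y : X \subset B -> even_set X -> e \in X -> joins e x y ->
  exists e' z, [/\ e' \in X, e' != e, joins e' y z & z != x].
Proof.
move=> XB ev eX j; have eB := subsetP XB _ eX.
have xy := adj_neq (joins_adj eB j).
have [e' /and3P[e'X ne inc]] : exists e', [&& e' \in X, e' != e &
    (s e' == y) (+) (t e' == y)].
  apply/existsP; apply: contraFT (ev y); rewrite negb_exists => /forallP no.
  rewrite (bigD1 e) //= (joins_incid _ j) eqxx (negPf xy) big1 // => e' /andP[eX' ne].
  by have := no e'; rewrite eX' ne => /negPf.
have [z jz] : exists z, joins e' y z.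
  move: inc; rewrite /joins; case: eqP => [_ _|_ /eqP ->]; last by exists (s e'); rewrite !eqxx orbT.
  by exists (t e'); rewrite eqxx.
exists e', z; split=> //; apply: contraNneq ne => zx.
by rewrite (simple (subsetP XB _ e'X) eB _ j) // joinsC -zx.
Qed.

Lemma sub_uniq_eq (X : {set E}) q : {subset q <= X} -> uniq q -> #|X| <= size q -> X =i q.
Proof.
move=> sub uq le x; have le' : size (enum X) <= size q by rewrite -cardE.
have sub' : {subset q <= enum X} by move=> y /sub; rewrite mem_enum.
by have [_ ->] := uniq_min_size uq sub' le'; rewrite mem_enum.
Qed.

Lemma even_list X q v : even_set X -> X =i q -> uniq q ->
  \big[addb/false]_(e <- q) ((s e == v) (+) (t e == v)) = false.
Proof. by move=> ev Xq uq; rewrite big_uniq // -[RHS](ev v); apply: eq_bigl. Qed.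

Lemma joins_neq e e' x y z w : joins e x y -> joins e' z w -> z != x -> z != y -> e' != e.
Proof.
move=> j j' zx zy; apply: contraTneq j' => ->; rewrite /joins.
by case/orP: j => /andP[/eqP -> /eqP ->];
  rewrite ![_ == z]eq_sym (negPf zx) (negPf zy) ?andbF.
Qed.

(** A walk from [e] that never turns back uses three distinct edges. It closes up after three or
    four edges, by parity. *)
Lemma even_small (X : {set E}) e x y : X \subset B -> even_set X -> e \in X -> joins e x y ->
  #|X| <= 4 ->
  (#|X| = 3 /\ exists e1 e2 z, tri X e e1 e2 x y z) \/
  (#|X| = 4 /\ exists e1 e2 e3 z w, quad X e e1 e2 e3 x y z w).
Proof.
move=> XB ev eX j le4; have inB d : d \in X -> d \in B by apply: (subsetP XB).
have [e1 [z [e1X n1 j1 zx]]] := even_next XB ev eX j.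
have [e2 [w [e2X n2 j2 wy]]] := even_next XB ev e1X j1.
have xy := adj_neq (joins_adj (inB _ eX) j).
have yz := adj_neq (joins_adj (inB _ e1X) j1).
have zw := adj_neq (joins_adj (inB _ e2X) j2).
have n20 : e2 != e by apply: joins_neq j j2 zx _; rewrite eq_sym.
have u3 : uniq [:: e; e1; e2].
  by rewrite /= !inE negb_or ![e == _]eq_sym n1 n20 ![e1 == _]eq_sym n2.
have s3 : {subset [:: e; e1; e2] <= X} by apply/allP; rewrite /= eX e1X e2X.
have [wx|wx] := eqVneq w x.
  subst w; left; have [le3|gt3] := leqP #|X| 3.
    have X3 := sub_uniq_eq s3 u3 le3; split; last by exists e1, e2, z.
    by rewrite (eq_card X3); apply/card_uniqP.
  (* A fourth edge besides a triangle would have odd degree at its own end [s e']. *)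
  have [e' e'X e'3] : exists2 e', e' \in X & e' \notin [:: e; e1; e2].
    apply/subsetPn; apply: contraTN gt3 => /subset_leq_card.
    by rewrite -leqNgt => /leq_trans; apply; apply: card_size.
  have u4 : uniq (e' :: [:: e; e1; e2]) by rewrite cons_uniq e'3.
  have X4 : X =i e' :: [:: e; e1; e2].
    by apply: sub_uniq_eq => // d; rewrite inE => /predU1P[->|/s3].
  have := even_list (s e') ev X4 u4.
  rewrite !big_cons big_nil (joins_incid _ j) (joins_incid _ j1) (joins_incid _ j2).
  have := adj_neq (B_adj (inB _ e'X)); rewrite eqxx [t e' == _]eq_sym => /negPf ->.
  by case: (x == _) (y == _) (z == _) => [] [] [].
right; have [e3 [u [e3X n3 j3 uz]]] := even_next XB ev e2X j2.
have n30 : e3 != e by apply: joins_neq j j3 wx wy.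
have n31 : e3 != e1 by apply: joins_neq j1 j3 wy _; rewrite eq_sym.
have u4 : uniq [:: e; e1; e2; e3].
  move: u3; rewrite /= !inE !negb_or ![_ == e3]eq_sym n30 n31 n3 !andbT.
  by case/andP=> /andP[-> ->] ->.
have s4 : {subset [:: e; e1; e2; e3] <= X} by apply/allP; rewrite /= eX e1X e2X e3X.
have X4 := sub_uniq_eq s4 u4 le4.
split; first by rewrite (eq_card X4); apply/card_uniqP.
have [ux|ux] := eqVneq u x.
  subst u; exists e1, e2, e3, z, w; split=> //.
  by rewrite /= !inE !negb_or xy yz zw ![_ == w]eq_sym wx wy eq_sym zx.
(* If the walk of four edges did not return to [x], then [x] would have degree one. *)
have := even_list x ev X4 u4.
rewrite !big_cons big_nil (joins_incid _ j) (joins_incid _ j1) (joins_incid _ j2).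
by rewrite (joins_incid _ j3) eqxx [y == x]eq_sym (negPf xy) (negPf zx) (negPf wx) (negPf ux).
Qed.

(** * Face boundaries *)

Definition bd f : {set E} := [set e in B | (l e == f) (+) (r e == f)].
Definition opp f e := if l e == f then r e else l e.

Lemma bdB f : bd f \subset B.
Proof. by apply/subsetP => e; rewrite inE => /andP[]. Qed.

(** This is [plane_map] for a single vertex and a single face. An edge with [f] on both sides counts
    twice, hence the [(+)] in [bd]. *)
Lemma bd_even f : even_set (bd f).
Proof.
move=> v; case: mapB => orth _ _; rewrite -[RHS](orth (pred1 v) (pred1 f)).
rewrite big_mkcond [RHS]big_mkcond; apply: eq_bigr => e _; rewrite inE /=.
by case: (e \in B) => //=; case: ifP => _; rewrite ?andbT ?andbF.
Qed.

Lemma opp_bd f e : e \in bd f -> e \in bd (opp f e).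
Proof.
rewrite !inE /opp => /andP[-> /=]; case: (eqVneq (l e) f) => [<-|ne] /=.
  by rewrite eqxx eq_sym => /negPf ->.
by move=> /eqP ->; rewrite eqxx eq_sym (negPf ne).
Qed.

Lemma opp_neq f e : e \in bd f -> opp f e != f.
Proof.
by rewrite !inE /opp => /andP[_]; case: (eqVneq (l e) f) => [<-|] //=.
Qed.

Lemma opp_uniq f g e : e \in bd f -> e \in bd g -> f != g -> opp f e = g.
Proof.
rewrite !inE /opp => /andP[_ ef] /andP[_ eg] fg; move: ef eg.
have [-> _ |ne /eqP ->] := eqVneq (l e) f; last by rewrite (negPf fg) addbF => /eqP.
by rewrite (negPf fg) => /eqP.
Qed.

Lemma three_faces f g h e : e \in bd f -> e \in bd g -> e \in bd h ->
  f != g -> f != h -> g = h.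
Proof. by move=> ef eg eh fg fh; rewrite -(opp_uniq ef eg fg) (opp_uniq ef eh fh). Qed.

(** If every edge lies on an even number of the listed boundaries, no edge leads from a listed face
    to another one, so dual connectedness makes the list contain all faces. *)
Lemma closed_faces f fs : uniq (f :: fs) -> size (f :: fs) < #|F| ->
  (forall e, e \in B -> \big[addb/false]_(g <- f :: fs) (e \in bd g) = false) -> False.
Proof.
case: mapB => _ _ conn; move: (f :: fs) (mem_head f fs) => q fq uq lt Bq.
have [g gq] : exists g, g \notin q.
  apply/existsP; rewrite -negb_forall; apply: contraTN lt => /forallP all.
  rewrite -leqNgt; apply: leq_trans (card_size q); apply/subset_leq_card/subsetP.
  by move=> x _; apply: all.
have H := conn (fun x => x \in q) _ f g; suff : true = false by [].
rewrite -[LHS]fq -[RHS](negPf gq); apply: H => e eB; apply/eqP.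
rewrite -[_ == _]negbK -negb_add negbK; apply/negPf; rewrite -[RHS](Bq e eB).
rewrite (mem_xor _ uq) (mem_xor (r e) uq) -big_split /=.
by apply: eq_bigr => x _; rewrite inE eB.
Qed.
(** [closed_faces] is applied to lists of at most four faces. *)
Hypothesis faces5 : 4 < #|F|.

(** * Triangular and quadrangular faces *)

Lemma tri_rot X e1 e2 e3 x y z : tri X e1 e2 e3 x y z -> tri X e2 e3 e1 y z x.
Proof.
case=> Xi u j1 j2 j3; split=> //; last by have := rot_uniq 1 [:: e1; e2; e3]; rewrite u.
by move=> e; rewrite Xi -[RHS](mem_rot 2).
Qed.

Lemma tri_rev X e1 e2 e3 x y z : tri X e1 e2 e3 x y z -> tri X e2 e1 e3 z y x.
Proof.
case=> Xi u j1 j2 j3; split; rewrite 1?joinsC //.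
  by move=> e; rewrite Xi !inE orbCA.
by move: u; rewrite /= !inE !negb_or [e2 == e1]eq_sym !andbT => /andP[/andP[-> ->] ->].
Qed.

Lemma quad_rot X e1 e2 e3 e4 x y z w :
  quad X e1 e2 e3 e4 x y z w -> quad X e2 e3 e4 e1 y z w x.
Proof.
case=> Xi u ux [j1 j2 j3 j4]; split=> //.
- by move=> e; rewrite Xi -[RHS](mem_rot 3).
- by have := rot_uniq 1 [:: e1; e2; e3; e4]; rewrite u.
- by have := rot_uniq 1 [:: x; y; z; w]; rewrite ux.
Qed.

Lemma quad_rev X e1 e2 e3 e4 x y z w :
  quad X e1 e2 e3 e4 x y z w -> quad X e2 e1 e4 e3 z y x w.
Proof.
case=> Xi u ux [j1 j2 j3 j4]; split; last by rewrite (joinsC e2) (joinsC e1) (joinsC e3) (joinsC e4).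
- by move=> e; rewrite Xi !inE; do 4!case: (e == _).
- by rewrite -(rot_uniq 2) -rev_uniq.
- by rewrite -rev_uniq -(rot_uniq 1).
Qed.

Lemma bd_tri f e x y : e \in bd f -> joins e x y -> #|bd f| == 3 ->
  exists e1 e2 z, tri (bd f) e e1 e2 x y z.
Proof.
move=> ef j /eqP c.
by case: (even_small (bdB f) (@bd_even f) ef j); rewrite c // => -[].
Qed.

Lemma bd_quad f e x y : e \in bd f -> joins e x y -> #|bd f| == 4 ->
  exists e1 e2 e3 z w, quad (bd f) e e1 e2 e3 x y z w.
Proof.
move=> ef j /eqP c.
by case: (even_small (bdB f) (@bd_even f) ef j); rewrite c // => -[].
Qed.

(** A face with empty boundary would be closed by itself, and a nonempty even set has at least three
    edges. *)
Lemma bd_card f : 2 < #|bd f|.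
Proof.
case: (set_0Vmem (bd f)) => [b0|[e ef]].
  case: (@closed_faces f [::]) => //; first by apply: leq_trans faces5.
  by move=> e _; rewrite big_seq1 b0 inE.
rewrite ltnNge; apply/negP => le2; have le4 := leq_trans le2 (isT : 2 <= 4).
have j : joins e (s e) (t e) by rewrite /joins !eqxx.
by case: (even_small (bdB f) (@bd_even f) ef j le4) => [[c _]|[c _]]; rewrite c in le2.
Qed.

Lemma tri_in X e1 e2 e3 x y z : tri X e1 e2 e3 x y z ->
  [/\ e1 \in X, e2 \in X & e3 \in X].
Proof. by case=> Xi _ _ _ _; rewrite !Xi !inE !eqxx !orbT. Qed.

Lemma quad_in X e1 e2 e3 e4 x y z w : quad X e1 e2 e3 e4 x y z w ->
  [/\ e1 \in X, e2 \in X, e3 \in X & e4 \in X].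
Proof. by case=> Xi _ _ _; rewrite !Xi !inE !eqxx !orbT. Qed.

Lemma tri_adj f e1 e2 e3 x y z : tri (bd f) e1 e2 e3 x y z ->
  [/\ adj x y, adj y z & adj z x].
Proof.
move=> T; have [i1 i2 i3] := tri_in T; case: T => _ _ j1 j2 j3.
by split; [apply: joins_adj j1 | apply: joins_adj j2 | apply: joins_adj j3];
  apply: (subsetP (bdB f)).
Qed.

Lemma quad_adj f e1 e2 e3 e4 x y z w : quad (bd f) e1 e2 e3 e4 x y z w ->
  [/\ adj x y, adj y z, adj z w & adj w x].
Proof.
move=> T; have [i1 i2 i3 i4] := quad_in T; case: T => _ _ _ [j1 j2 j3 j4].
by split; [apply: joins_adj j1 | apply: joins_adj j2 | apply: joins_adj j3 |
  apply: joins_adj j4]; apply: (subsetP (bdB f)).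
Qed.

Lemma bd_simple f g e e' x y : e \in bd f -> e' \in bd g ->
  joins e x y -> joins e' x y -> e = e'.
Proof. by move=> /(subsetP (bdB f)) eB /(subsetP (bdB g)); apply: simple. Qed.

(** By simplicity both faces have the same boundary, so the two together are closed. *)
Lemma tri_unique f g e d1 d2 d3 e2 e3 x y z : f != g ->
  tri (bd f) e d2 d3 x y z -> tri (bd g) d1 e2 e3 x y z -> False.
Proof.
move=> fg Tf Tg; have [i1 i2 i3] := tri_in Tf; have [i1' i2' i3'] := tri_in Tg.
case: Tf => Xf uf j1 j2 j3; case: Tg => Xg ug j1' j2' j3'.
have E1 := bd_simple i1 i1' j1 j1'; have E2 := bd_simple i2 i2' j2 j2'.
have E3 := bd_simple i3 i3' j3 j3'; subst.
apply: (@closed_faces f [:: g]); first by rewrite /= inE fg.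
  by apply: leq_trans faces5.
by move=> e _; rewrite !big_cons big_nil Xf Xg addbF addbb.
Qed.

(** Let [w] and [w'] be the apexes of the two neighbours. If they agree, [x y z w] is a K4;
    otherwise the cycle [x w y w' z] with chord [x y] is a Theta5. *)
Lemma tri_two_tris f e1 e2 e3 x y z : tri (bd f) e1 e2 e3 x y z ->
  #|bd (opp f e1)| == 3 -> #|bd (opp f e2)| == 3 -> False.
Proof.
move=> T c1 c2; have [i1 i2 i3] := tri_in T; have [_ u j1 j2 j3] := T.
have n1 := opp_neq i1; have n2 := opp_neq i2.
have [d2 [d3 [w T1]]] := bd_tri (opp_bd i1) j1 c1.
have [g2 [g3 [w' T2]]] := bd_tri (opp_bd i2) j2 c2.
have wz : w != z by apply/eqP => wz; subst; apply: (tri_unique n1 T1 T).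
have wx : w' != x.
  by apply/eqP => wx; subst; apply: (tri_unique n2 T2 (tri_rot T)).
have [xy yz zx] := tri_adj T; have [_ yw wx'] := tri_adj T1.
have [_ zw' w'y] := tri_adj T2.
have [ww|ww] := eqVneq w w'.
  subst w'; apply: (@noK4 x y z w) => //; by rewrite adj_sym.
apply: (@noTheta5 x w y w' z) => //; try by rewrite adj_sym.
rewrite /= !inE !negb_or !andbT wz ww [x == w']eq_sym wx.
by rewrite [x == w]eq_sym (adj_neq wx') (adj_neq xy) [x == z]eq_sym (adj_neq zx)
  [w == y]eq_sym (adj_neq yw) [y == w']eq_sym (adj_neq w'y) (adj_neq yz)
  [w' == z]eq_sym (adj_neq zw').
Qed.

(** A vertex [z] off the 4-cycle would give the 5-cycle [x z y p q] with chord [x y]. *)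
Lemma tri_c4 x y z p q : adj x y -> adj y z -> adj z x ->
  uniq [:: x; y; p; q] -> adj y p -> adj p q -> adj q x -> z = p \/ z = q.
Proof.
move=> xy yz zx u yp pq qx; have [->|zp] := eqVneq z p; first by left.
have [->|zq] := eqVneq z q; first by right.
case: (@noTheta5 x z y p q) => //; try by rewrite adj_sym.
move: u; rewrite /= !inE !negb_or !andbT zp zq (adj_neq xy) [x == z]eq_sym (adj_neq zx).
rewrite [z == y]eq_sym (adj_neq yz) /=.
by case/andP=> /andP[-> ->] /andP[/andP[-> ->] ->].
Qed.

(** By [tri_c4] the third vertex of the triangle lies on the quadrangle, so a second edge is shared,
    next to the first. Rotation brings the shared edges to the front. *)
Lemma tri_quad f g e : e \in bd f -> e \in bd g -> #|bd f| == 3 -> #|bd g| == 4 ->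
  exists e1 e2 e3 q3 q4 x y z w,
    tri (bd f) e1 e2 e3 x y z /\ quad (bd g) e1 e2 q3 q4 x y z w.
Proof.
move=> ef eg cf cg; have j : joins e (s e) (t e) by rewrite /joins !eqxx.
move: (s e) (t e) j => x y j.
have [a2 [a3 [z T]]] := bd_tri ef j cf.
have [q2 [q3 [q4 [p [q Q]]]]] := bd_quad eg j cg.
have [xy yz zx] := tri_adj T; have [_ yp pq qx] := quad_adj Q.
have [_ i2 i3] := tri_in T; have [_ k2 k3 k4] := quad_in Q.
have [_ _ _ j2 j3] := T; have [_ _ u [_ l2 l3 l4]] := Q.
case: (tri_c4 xy yz zx u yp pq qx) => zE; subst z.
  by rewrite (bd_simple k2 i2 l2 j2) in Q; exists e, a2, a3, q3, q4, x, y, p, q.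
rewrite (bd_simple k4 i3 l4 j3) in Q; exists a3, e, a2, q2, q3, q, x, y, p.
by split; [apply/tri_rot/tri_rot | apply/quad_rot/quad_rot/quad_rot].
Qed.

(** * Quadrangular faces that meet a triangular face *)

Definition hot f := (#|bd f| == 4) && [exists e in bd f, #|bd (opp f e)| == 3].

(** The triangle [x y z] and the quadrangle [x y z b] share the path through [y], and [h] lies
    across [z b]. The face across [b x] is covered by reflection. *)
Section HotNeighbour.
Variables (f g : F) (e1 e2 e3 q3 q4 : E) (x y z b : V).
Hypothesis T : tri (bd f) e1 e2 e3 x y z.
Hypothesis Q : quad (bd g) e1 e2 q3 q4 x y z b.

Let h := opp g q3.
Let fg : f != g.
Proof.
case: T => Xf _ _ _ _; case: Q => Xg u _ _; apply/eqP => fE.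
have : #|bd f| = 3 by rewrite (eq_card Xf); apply/card_uniqP; case: T.
rewrite fE (eq_card Xg) => c; have := card_uniqP u; by rewrite c.
Qed.
Let gh : g != h. Proof. by rewrite eq_sym; apply: opp_neq; case: (quad_in Q). Qed.
Let hq3 : q3 \in bd h. Proof. by apply: opp_bd; case: (quad_in Q). Qed.

Let uq : [/\ [&& x != y, x != z & x != b], (y != z) && (y != b) & z != b].
Proof.
case: Q => _ _; rewrite /= !inE !negb_or !andbT.
by case/and3P=> /and3P[-> -> ->] /andP[-> ->] -> _.
Qed.

(** With the side [x z] of the triangle, the diagonal [y b] would complete a K4. *)
Let no_yb : adj y b -> False.
Proof.
move=> yb; have [xy yz zx] := tri_adj T; have [_ _ zb bx] := quad_adj Q.
by apply: (@noK4 x y z b) => //; rewrite adj_sym.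
Qed.

Let fh : f != h.
Proof.
apply/eqP => fE; have q3f : q3 \in bd f by rewrite fE.
case: T => Xf _ _ _ j3; case: Q => _ u _ [_ _ k3 _]; case: uq => /and3P[xy xz xb] _ _.
move: q3f u; rewrite Xf !inE /= => /or3P[] /eqP D; rewrite D ?inE ?eqxx ?orbT ?andbF //.
have n := joins_neq k3 (etrans (joinsC e3 x z) j3) xz xb.
by rewrite D eqxx in n.
Qed.

(** Suppose [h] is a triangle with apex [w]. If [w] is [x], the faces [f], [g], [h] are closed; if
    [w] is [y], the diagonal [y b] appears; otherwise [x y z w b] with chord [x z] is a Theta5. *)
Lemma hot_opp_ge4 : #|bd h| != 3.
Proof.
apply/eqP => /eqP c; case: (T) => Xf uf j1 j2 j3; case: (Q) => Xg ug _ [_ _ k3 k4].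
have [i1 i2 i3] := tri_in T; have [_ _ _ i4] := quad_in Q.
have [g2 [g3 [w H]]] := bd_tri hq3 k3 c.
have [xy yz zx] := tri_adj T; have [_ _ zb bx] := quad_adj Q.
have [_ bw wz] := tri_adj H; have [_ m2 m3] := tri_in H; case: (H) => Xh uh _ l2 l3.
case: uq => /and3P[nxy nxz nxb] /andP[nyz nyb] nzb.
have [wE|wx] := eqVneq w x.
  subst w; rewrite (bd_simple m2 i4 l2 k4) in Xh uh.
  have g3e : g3 = e3 by apply: (bd_simple m3 i3 l3); rewrite joinsC.
  rewrite g3e in Xh uh.
  apply: (@closed_faces f [:: g; h]); first by rewrite /= !inE !negb_or fg fh gh.
    by apply: leq_trans faces5.
  move=> e _; rewrite !big_cons big_nil Xf Xg Xh !mem_xor // !big_cons !big_nil.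
  by do 5!case: (e == _).
have [wE|wy] := eqVneq w y; first by apply: no_yb; rewrite adj_sym -wE.
apply: (@noTheta5 x y z w b) => //; try by rewrite adj_sym.
rewrite /= !inE !negb_or !andbT nxy nxz nxb nyz nyb nzb ![_ == w]eq_sym wx wy.
by rewrite (adj_neq wz) [w == b]eq_sym (adj_neq bw).
Qed.

(** The graph triangle [x z b], which need not bound a face, meets the quadrangle [z b p q] of [h]
    in [z b], so [x] is [p] or [q]. In the first case a triangular neighbour of [h] closes up four
    faces; in the second a K4 arises. *)
Lemma hot_opp_not_hot : ~~ hot h.
Proof.
apply/negP => /andP[c /exists_inP[d dh cd]].
case: (T) => Xf uf j1 j2 j3; case: (Q) => Xg ug _ [k1 k2 k3 k4].
have [i1 i2 i3] := tri_in T; have [i1' i2' i3' i4'] := quad_in Q.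
have [g2 [g3 [g4 [p [q H]]]]] := bd_quad hq3 k3 c.
have [xy yz zx] := tri_adj T; have [_ _ zb bx] := quad_adj Q.
have [_ bp pq qz] := quad_adj H; have [_ m2 m3 m4] := quad_in H.
case: (H) => Xh uh up [_ l2 l3 l4].
case: uq => /and3P[nxy nxz nxb] /andP[nyz nyb] nzb.
have cg : #|bd g| = 4 by rewrite (eq_card Xg); apply/card_uniqP.
have xb : adj x b by rewrite adj_sym.
have xz : adj x z by rewrite adj_sym.
have bz : adj b z by rewrite adj_sym.
have [xE|xE] : x = p \/ x = q by apply: (@tri_c4 z b x p q).
  subst p; have g2E := bd_simple m2 i4' l2 k4; subst g2.
  pose k := opp h d; have dk : d \in bd k := opp_bd dh.
  have kh : k != h := opp_neq dh.
  have kg : g != k by apply/eqP => gk; move: cd; rewrite -/k -gk cg.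
  have hg : h != g by rewrite eq_sym.
  have hk : h != k by rewrite eq_sym.
  have no3 e : e \in bd g -> e \in bd h -> e \in bd k -> False.
    by move=> eg eh ek; move: kg; rewrite (three_faces eh eg ek hg hk) eqxx.
  have [dn3 dn4] : d <> q3 /\ d <> q4.
    by split=> dE; [apply: (no3 q3) | apply: (no3 q4)]; rewrite // -dE.
  have qx : adj q x by rewrite adj_sym.
  have zq : adj z q by rewrite adj_sym.
  (* The edge [d] is [x q] or [q z]. By [tri_c4] the apex of [k] lies on the 4-cycle [x q z b]; it
     is not [b], as [k] would then contain [q3] or [q4], which already lie on [g] and [h]. *)
  have K : tri (bd k) g3 g4 e3 x q z.
    have := dh; rewrite Xh !inE => /or4P[] /eqP // dE; subst d.
      have [a2 [a3 [w K]]] := bd_tri dk l3 cd.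
      have [_ n2 n3] := tri_in K; have [_ _ _ p2 p3] := K; have [_ qw wx] := tri_adj K.
      have up' : uniq [:: x; q; z; b] by rewrite -(rot_uniq 2).
      have [wE|wE] := tri_c4 pq qw wx up' qz zb bx.
      - subst w; rewrite (bd_simple n2 m4 p2 l4) in K.
        by rewrite (bd_simple n3 i3 p3 j3) in K.
      - by subst w; case: (no3 q4); rewrite // -(bd_simple n3 i4' p3 k4).
    have [a2 [a3 [w K]]] := bd_tri dk l4 cd.
    have [_ n2 n3] := tri_in K; have [_ _ _ p2 p3] := K; have [_ zw wq] := tri_adj K.
    have up' : uniq [:: q; z; b; x] by rewrite -(rot_uniq 1).
    have [wE|wE] := tri_c4 qz zw wq up' zb bx pq.
    - by subst w; case: (no3 q3); rewrite // -(bd_simple n2 i3' p2 k3).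
    - subst w; rewrite (bd_simple n2 i3 p2 j3) in K.
      by rewrite (bd_simple n3 m3 p3 l3) in K; apply/tri_rot/tri_rot.
  have [Xk uk _ _ _] := K.
  have fk : f != k.
    apply/eqP => fk; have := i1; rewrite fk Xk !inE => /or3P[] /eqP eE.
    - by apply: (no3 e1); rewrite // -?fk // eE.
    - by apply: (no3 e1); rewrite // -?fk // eE.
    - by move: uf; rewrite eE /= !inE eqxx orbT.
  (* Each of the seven edges [e1], [e2], [e3], [q3], [q4], [g3], [g4] lies on exactly two of the
     four faces. *)
  apply: (@closed_faces f [:: g; h; k]); last 1 first.
  - move=> e _; rewrite !big_cons big_nil Xf Xg Xh Xk !mem_xor // !big_cons !big_nil.
    by do 7!case: (e == _).
  - by rewrite /= !inE !negb_or fg fh gh fk kg hk.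
  - exact: faces5.
subst q.
(* Now [x z b p] is a 4-cycle sharing [x z] with the triangle [x z y], so [y] is [b] or [p]; the
   latter makes [y] adjacent to [b]. *)
have zy : adj z y by rewrite adj_sym.
have yx : adj y x by rewrite adj_sym.
have up' : uniq [:: x; z; b; p] by rewrite -(rot_uniq 1).
have [yE|yE] := tri_c4 xz zy yx up' zb bp pq.
- by rewrite yE eqxx in nyb.
- by apply: no_yb; rewrite yE adj_sym.
Qed.
End HotNeighbour.

(** * Levels and charges of faces *)

Definition lev f := if #|bd f| == 3 then 2 else if hot f then 1 else 0.

(* The share of a face of level [m] in the 28 units of an edge whose other face
   has level [n]. *)
Definition share (m n : nat) : nat :=
  match m, n with
  | 2, 0 | 2, 1 => 18 | 0, 2 | 1, 2 => 10 | 1, 0 => 15 | 0, 1 => 13 | _, _ => 14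
  end.

Lemma lev_cases f : [\/ lev f = 0, lev f = 1 | lev f = 2].
Proof.
by rewrite /lev; case: ifP => _; [constructor 3 | case: ifP => _; [constructor 2 | constructor 1]].
Qed.

Lemma share_sum f g : share (lev f) (lev g) + share (lev g) (lev f) = 28.
Proof. by case: (lev_cases f) => ->; case: (lev_cases g) => ->. Qed.

Lemma share_ge10 f g : 10 <= share (lev f) (lev g).
Proof. by case: (lev_cases f) => ->; case: (lev_cases g) => ->. Qed.

Lemma sum_bd f q (w : E -> nat) : bd f =i q -> uniq q ->
  \sum_(e in bd f) w e = \sum_(e <- q) w e.
Proof. by move=> fq uq; rewrite big_uniq //; apply: eq_bigl. Qed.

(** A triangle has at most one triangular neighbour: 14 + 18 + 18. A hot quadrangle gets at least 10
    from each of the two edges shared with a triangle and 15 from each of the others. Any other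
    quadrangle gets at least 4 times 13, and a longer face at least 5 times 10. *)
Lemma face_share f : 50 <= \sum_(e in bd f) share (lev f) (lev (opp f e)).
Proof.
have [c3|n3] := eqVneq #|bd f| 3.
  have lf : lev f = 2 by rewrite /lev c3.
  have [e ef] : exists e, e \in bd f by apply/card_gt0P; rewrite c3.
  have j : joins e (s e) (t e) by rewrite /joins !eqxx.
  have [e1 [e2 [z T]]] := bd_tri ef j (introT eqP c3).
  have [Xf uf _ _ _] := T; rewrite (sum_bd _ Xf uf) !big_cons big_nil lf.
  have sh d : share 2 (lev (opp f d)) = if #|bd (opp f d)| == 3 then 14 else 18.
    by rewrite /lev; case: ifP => //; case: ifP.
  have := tri_two_tris T; have := tri_two_tris (tri_rot T).
  have := tri_two_tris (tri_rot (tri_rot T)); rewrite !sh.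
  do 3!case: (_ == 3) => //=; by move=> *; exfalso; auto.
have [c4|n4] := eqVneq #|bd f| 4; last first.
  have c5 : 4 < #|bd f|.
    by have := bd_card f; rewrite 2!leq_eqVlt eq_sym (negPf n3) [4 == _]eq_sym (negPf n4).
  apply: (@leq_trans (\sum_(e in bd f) 10)); first by rewrite sum_nat_const; lia.
  by apply: leq_sum => e _; apply: share_ge10.
have [hf|nhf] := boolP (hot f); last first.
  have lf : lev f = 0 by rewrite /lev c4 (negPf nhf).
  apply: (@leq_trans (\sum_(e in bd f) 13)); first by rewrite sum_nat_const c4.
  apply: leq_sum => e ef; rewrite lf.
  have : #|bd (opp f e)| != 3.
    apply: contraNneq nhf => ce; rewrite /hot c4 eqxx; apply/exists_inP; exists e => //.
    by rewrite ce.
  by rewrite /lev => /negPf ->; case: ifP.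
have lf : lev f = 1 by rewrite /lev c4 hf.
have /andP[_ /exists_inP[e ef ce]] := hf.
have [e1 [e2 [e3 [q3 [q4 [x [y [z [w [T Q]]]]]]]]]] :=
  tri_quad (opp_bd ef) ef ce (introT eqP c4).
have [Xf uf _ _] := Q; rewrite (sum_bd _ Xf uf) !big_cons big_nil lf.
have s15 d : #|bd (opp f d)| != 3 -> ~~ hot (opp f d) -> 15 <= share 1 (lev (opp f d)).
  by move=> /negPf n /negPf h; rewrite /lev n h.
have h3 := s15 _ (hot_opp_ge4 T Q) (hot_opp_not_hot T Q).
have h4 := s15 _ (hot_opp_ge4 (tri_rev T) (quad_rev Q))
  (hot_opp_not_hot (tri_rev T) (quad_rev Q)).
have := share_ge10 f (opp f e1); have := share_ge10 f (opp f e2).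
rewrite lf; lia.
Qed.

(** Double counting: an edge between two distinct faces gives out all of its 28 units, an edge with
    the same face on both sides gives nothing. *)
Lemma total_share :
  \sum_f \sum_(e in bd f) share (lev f) (lev (opp f e)) <= 28 * #|B|.
Proof.
rewrite (exchange_big_dep (mem B)) /= => [|f e _]; last by apply: (subsetP (bdB f)).
rewrite mulnC -sum_nat_const; apply: leq_sum => e eB.
have [lr|lr] := eqVneq (l e) (r e).
  by rewrite big1 // => f; rewrite inE eB lr addbb.
rewrite (bigD1 (l e)) /=; last by rewrite inE eB eqxx eq_sym (negPf lr).
rewrite (bigD1 (r e)) /=; last by rewrite inE eB eqxx (negPf lr) eq_sym lr.
rewrite big1 ?addn0 => [|f]; last first.
  by rewrite inE eB /= => /andP[/andP[]]; rewrite ![f == _]eq_sym; do 2!case: (_ == f).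
by rewrite /opp eqxx (negPf lr) share_sum.
Qed.

End Discharging.

Lemma plane_map_bound (V E F : finType) (adj : rel V) (s t : E -> V) (l r : E -> F)
    (B : {set E}) :
  symmetric adj -> irreflexive adj ->
  (forall x y z w, adj x y -> adj x z -> adj x w ->
    adj y z -> adj y w -> adj z w -> False) ->
  (forall a b c d e, uniq [:: a; b; c; d; e] ->
    adj a b -> adj b c -> adj c d -> adj d e -> adj e a -> adj a c -> False) ->
  plane_map s t l r B -> (forall e, e \in B -> adj (s e) (t e)) ->
  (forall e e' x y, e \in B -> e' \in B ->
    joins s t e x y -> joins s t e' x y -> e = e') ->
  5 < #|V| -> 11 * #|B| + 50 <= 25 * #|V|.
Proof.
move=> sym irr K4 Th mapB Badj simple V6; have [_ euler _] := mapB.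
(* With at most four faces, Euler gives [#|B| <= #|V| + 2], which suffices as [5 < #|V|]. *)
have [F5|] := ltnP 4 #|F|; last by lia.
have le50 : 50 * #|F| <= 28 * #|B|.
  apply: leq_trans (total_share l r B); rewrite mulnC -sum_nat_const.
  apply: leq_sum => f _.
  exact: (face_share sym irr K4 Th mapB Badj simple F5).
lia.
Qed.

(** * Graphs that are minors of a grid *)

Lemma no_K4 (G : sgraph) : ~ contains G K4 -> forall x y z w : G,
  adj x y -> adj x z -> adj x w -> adj y z -> adj y w -> adj z w -> False.
Proof.
move=> no x y z w xy xz xw yz yw zw; apply: no.
pose f (i : 'I_4) := nth x [:: x; y; z; w] i.
have fadj i j : K4_adj i j -> adj (f i) (f j).
  by case: i j => [[|[|[|[|?]]]] ?] [[|[|[|[|?]]]] ?] //= _; rewrite /f //= adj_sym.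
(* Injectivity is automatic: distinct vertices of K4 are adjacent, and adjacent images differ. *)
exists f; split=> // i j fij; apply/eqP; apply: contraT => /fadj.
by rewrite fij adj_irr.
Qed.

Lemma no_Theta5 (G : sgraph) : ~ contains G Theta5 -> forall a b c d e : G,
  uniq [:: a; b; c; d; e] ->
  adj a b -> adj b c -> adj c d -> adj d e -> adj e a -> adj a c -> False.
Proof.
move=> no a b c d e u ab bc cd de ea ac; apply: no.
exists (fun i : 'I_5 => nth a [:: a; b; c; d; e] i); split.
  by move=> i j /eqP; rewrite nth_uniq //= => /eqP /val_inj.
by case=> [[|[|[|[|[|?]]]]] ?] [[|[|[|[|[|?]]]]] ?] //= _; rewrite // adj_sym.
Qed.

Lemma edgesP (G : sgraph) (S : {set G}) :
  reflect (exists x y, adj x y /\ S = [set x; y]) (S \in edges G).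
Proof.
rewrite inE; apply: (iffP existsP) => [[x /existsP[y /andP[xy /eqP ->]]]|].
  by exists x, y.
by move=> [x [y [xy ->]]]; exists x; apply/existsP; exists y; rewrite xy eqxx.
Qed.

(** The classes of [lam0] are branch sets. They are extended to the whole grid, and one grid edge is
    kept for each edge of [G]; contraction then yields a plane map. *)
Lemma grid_minor_bound (G : sgraph) (M : nat) (lam0 : grid_vertex M -> option G) :
  ~ contains G K4 -> ~ contains G Theta5 -> 5 < #|G| ->
  (forall v, exists q, lam0 q = Some v) ->
  (forall P : grid_vertex M -> bool,
    (forall e, lam0 (grid_src e) -> lam0 (grid_src e) = lam0 (grid_tgt e) ->
      P (grid_src e) = P (grid_tgt e)) ->
    forall x y, lam0 x -> lam0 x = lam0 y -> P x = P y) ->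
  (forall x y, adj x y -> exists e,
    (lam0 (grid_src e) = Some x /\ lam0 (grid_tgt e) = Some y) \/
    (lam0 (grid_src e) = Some y /\ lam0 (grid_tgt e) = Some x)) ->
  11 * #|edges G| + 50 <= 25 * #|G|.
Proof.
move=> /no_K4 K4 /no_Theta5 Th V5 sur0 conn0 edge0.
(* An edge of [G] supplies a grid edge [e0], the default value of [h] on sets that are not edges. *)
have [E0|[S0 /edgesP[a0 [b0 [ab0 _]]]]] := set_0Vmem (edges G).
  by rewrite E0 cards0; lia.
have [e0 _] := edge0 _ _ ab0.
have [|lam [ext conn]] := extend_labelling (@grid_conn M) _ conn0.
  by have [q lq] := sur0 a0; exists q; rewrite lq.
have sur w : exists v, lam v = w by have [q /ext lq] := sur0 w; exists q.
pose sl e := lam (grid_src e); pose tl e := lam (grid_tgt e).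
have [h hP] : exists h : {set G} -> grid_edge M,
    forall S, S \in edges G -> [set sl (h S); tl (h S)] = S.
  apply: (@fin_all_exists _ _ (fun S e => S \in edges G -> [set sl e; tl e] = S)) => S.
  have [/edgesP[x [y [/edge0[e eP] ->]]]|] := boolP (S \in edges G); last by exists e0.
  exists e => _; rewrite /sl /tl.
  by case: eP => -[/ext -> /ext ->] //; rewrite setUC.
have mapA := grid_plane_map M.
pose B := h @: edges G.
have Bl e : e \in B -> adj (sl e) (tl e).
  case/imsetP=> S SE ->; have := hP S SE; case/edgesP: SE (h S) => x [y [xy ->]] d.
  move/setP=> eq; have := eq x; have := eq y; have := eq (sl d).
  have := eq (tl d); rewrite !inE !eqxx !orbT /=.
  have nxy : x != y by apply: contraTneq xy => ->; rewrite adj_irr.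
  move=> /esym/orP[] /eqP -> /esym/orP[] /eqP -> //.
  - by rewrite orbb eq_sym (negPf nxy).
  - by rewrite adj_sym.
  - by rewrite !orbb => _; rewrite (negPf nxy).
have [| |F' [l' [r' mapB]]] := @minor_plane_map _ _ _ _ _ _ _ _ _ B lam mapA sur _ (subsetT _).
- by move=> P Pe; apply: conn => e; apply: Pe; rewrite inE.
- by move=> e /Bl; rewrite /sl /tl => /[swap] ->; rewrite adj_irr.
have cB : #|B| = #|edges G|.
  by apply: card_in_imset => S S' SE SE' hS; rewrite -(hP S SE) hS hP.
rewrite -cB; apply: (plane_map_bound (@adj_sym G) (@adj_irr G) K4 Th mapB) => //.
have js e x y : joins (lam \o @grid_src M) (lam \o @grid_tgt M) e x y ->
    [set sl e; tl e] = [set x; y].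
  by rewrite /joins /sl /tl => /orP[] /andP[/eqP /= -> /eqP /= ->] //; rewrite setUC.
move=> e e' x y /imsetP[S SE ->] /imsetP[S' SE' ->] /js j /js j'.
by rewrite -(hP S SE) -(hP S' SE') j j'.
Qed.

From mathcomp Require Import all_classical all_reals all_analysis.
Import Order.TTheory GRing.Theory Num.Theory.
Import numFieldNormedType.Exports.

Local Open Scope ring_scope.

(** * Arcs in the plane *)

Section Arcs.
Variable R : realType.

Definition close (d : R) (p q : R * R) := (`|p.1 - q.1| < d) && (`|p.2 - q.2| < d).

Lemma closeC d p q : close d p q = close d q p.
Proof. by rewrite /close distrC [`|p.2 - _|]distrC. Qed.

Lemma close_trans d1 d2 p q u : close d1 p q -> close d2 q u -> close (d1 + d2) p u.
Proof.
rewrite /close !ltr_distl => /andP[/andP[? ?] /andP[? ?]] /andP[/andP[? ?] /andP[? ?]].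
by apply/andP; split; apply/andP; split; lra.
Qed.

Lemma close_le d1 d2 p q : d1 <= d2 -> close d1 p q -> close d2 p q.
Proof. by move=> d12 /andP[h1 h2]; rewrite /close !(lt_le_trans _ d12). Qed.

Lemma not_close p q : p <> q -> exists2 d : R, 0 < d & ~~ close d p q.
Proof.
case: p q => [p1 p2] [q1 q2] pq; have [e1|n1] := eqVneq p1 q1.
  have [e2|n2] := eqVneq p2 q2; first by rewrite e1 e2 in pq.
  exists `|p2 - q2|; first by rewrite normr_gt0 subr_eq0.
  by rewrite /close /= ltxx andbF.
exists `|p1 - q1|; first by rewrite normr_gt0 subr_eq0.
by rewrite /close /= ltxx.
Qed.

(** Compactness of the unit interval: a property valid near each point for all small [d] holds
    everywhere for one [d]. *)
Lemma segment_uniform (P : R -> R -> Prop) :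
  (forall x : R, 0 <= x <= 1 -> exists2 d0 : R, 0 < d0 & forall d y : R, 0 < d < d0 ->
    0 <= y <= 1 -> `|x - y| < d0 -> P d y) ->
  exists2 d : R, 0 < d & forall y : R, 0 <= y <= 1 -> P d y.
Proof.
move=> Ploc; have := @segment_compact R 0 1.
move=> /compact_near_coveringP/near_covering_withinP.
move=> /(_ R (at_right (0 : R)) P _) [].
  move=> x; rewrite /= in_itv /= => x01; have [d0 d0_gt0 Pd] := Ploc x x01.
  exists (ball x d0, fun d : R => is_true (0 < d < d0)).
    split => /=; first exact: nbhsx_ballx.
    by near=> d; apply/andP; split; near: d; [exact: nbhs_right_gt | exact: nbhs_right_lt].
  move=> [y d] /= [xy dd]; rewrite in_itv /= => y01.
  exact: Pd.
move=> d /= d_gt0 H; exists (d / 2); first by rewrite divr_gt0.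
move=> y y01; apply: H; rewrite /= ?in_itv //= ?divr_gt0 //.
rewrite sub0r normrN gtr0_norm ?divr_gt0 //; lra.
Unshelve. all: by end_near. Qed.

Lemma arc_cont (g : R -> R * R) x e : {within `[0, 1], continuous g}%classic ->
  0 <= x <= 1 -> 0 < e ->
  exists2 d : R, 0 < d & forall y : R, 0 <= y <= 1 -> `|x - y| < d -> close e (g x) (g y).
Proof.
move=> /subspace_continuousP gc x01 e0.
have /gc : (`[0, 1]%classic : set R) x by rewrite /= in_itv.
move=> /cvg_ballP /(_ e e0); rewrite near_withinE => -[d /= d0 H].
exists d => // y y01 xy; have [] := H y xy; first by rewrite /= in_itv.
by rewrite /close => -> ->.
Qed.

Lemma arc_unif (g : R -> R * R) e : {within `[0, 1], continuous g}%classic ->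
  0 < e -> exists2 d : R, 0 < d & forall s t : R, 0 <= s <= 1 -> 0 <= t <= 1 ->
    `|s - t| < d -> close e (g s) (g t).
Proof.
move=> gc e0.
have [|d d0 H] := @segment_uniform (fun d s => forall t : R, 0 <= t <= 1 -> `|s - t| < d ->
    close e (g s) (g t)); last by exists d => // s t s01 t01; apply: H.
move=> x x01; have e2 : 0 < e / 2 by rewrite divr_gt0.
have [d d0 H] := arc_cont gc x01 e2.
exists (d / 2); first by rewrite divr_gt0.
move=> d' y /andP[_ d'd] y01 xy t t01 yt.
have -> : e = e / 2 + e / 2 by lra.
apply: (@close_trans _ _ _ (g x)); first by rewrite closeC; apply: H; lra.
apply: H => //; move: xy yt; rewrite !ltr_distl => /andP[? ?] /andP[? ?].
by apply/andP; split; lra.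
Qed.

Lemma arc_bounded (g : R -> R * R) : {within `[0, 1], continuous g}%classic ->
  exists2 b : R, 0 < b & forall t : R, 0 <= t <= 1 -> close b 0 (g t).
Proof.
move=> gc.
(* The bound is sought as [d^-1], so that small [d] means a weak requirement. *)
have [|d d0 H] := @segment_uniform (fun d s => close d^-1 0 (g s)); last first.
  by exists d^-1; rewrite ?invr_gt0.
move=> x x01; have [d d0 H] := arc_cont gc x01 ltr01.
pose b := `|(g x).1| + `|(g x).2| + 1.
have b1 : 1 <= b by rewrite lerDr addr_ge0.
have cb : close b 0 (g x).
  rewrite /close /b !sub0r !normrN; have := normr_ge0 (g x).1; have := normr_ge0 (g x).2.
  by move=> ? ?; apply/andP; split; lra.
have b0 : 0 < b + 1 by lra.
exists (Num.min d (b + 1)^-1); first by rewrite lt_min d0 invr_gt0.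
move=> d' y /andP[d'0]; rewrite lt_min => /andP[_ d'b] y01; rewrite lt_min => /andP[xy _].
apply: (@close_le (b + 1)); last exact: close_trans cb (H _ y01 xy).
by rewrite -[b + 1]invrK lef_pV2 ?posrE ?invr_gt0 // ltW.
Qed.

Lemma arc_avoid (g : R -> R * R) p : {within `[0, 1], continuous g}%classic ->
  (forall t : R, 0 <= t <= 1 -> p <> g t) ->
  exists2 d : R, 0 < d & forall t : R, 0 <= t <= 1 -> ~~ close d p (g t).
Proof.
move=> gc pg; apply: segment_uniform => x x01.
have [e e0 pe] := not_close (pg x x01); have e2 : 0 < e / 2 by rewrite divr_gt0.
have [d d0 H] := arc_cont gc x01 e2.
exists (Num.min d (e / 2)); first by rewrite lt_min d0.
move=> d' y /andP[_]; rewrite lt_min => /andP[_ d'e] y01; rewrite lt_min => /andP[xy _].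
apply: contra pe => pc; have -> : e = e / 2 + e / 2 by lra.
apply: (@close_trans _ _ _ (g y)); first by apply: close_le pc; lra.
by rewrite closeC; apply: H.
Qed.

(** [K] contains the points where the arcs may meet. Outside the [e]-boxes around [K], compactness
    turns disjointness into a positive distance. *)
Lemma arcs_apart (g f : R -> R * R) (K : R * R -> Prop) e :
  {within `[0, 1], continuous g}%classic ->
  {within `[0, 1], continuous f}%classic -> 0 < e ->
  (forall s : R, 0 <= s <= 1 ->
    (exists2 p, K p & p = g s) \/ forall t : R, 0 <= t <= 1 -> g s <> f t) ->
  exists2 d : R, 0 < d & forall s : R, 0 <= s <= 1 -> (forall p, K p -> ~~ close e p (g s)) ->
    forall t : R, 0 <= t <= 1 -> ~~ close d (g s) (f t).
Proof.
move=> gc fc e0 gf; apply: segment_uniform => x x01.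
case: (gf x x01) => [[p Kp px]|gx].
  have [d d0 H] := arc_cont gc x01 e0; exists d => // d' y _ y01 xy no.
  by have := no p Kp; rewrite px H.
have [n n0 gn] := arc_avoid fc gx; have n2 : 0 < n / 2 by rewrite divr_gt0.
have [d d0 H] := arc_cont gc x01 n2.
exists (Num.min d (n / 2)); first by rewrite lt_min d0.
move=> d' y /andP[_]; rewrite lt_min => /andP[_ d'n] y01; rewrite lt_min => /andP[xy _] _ t t01.
apply: contra (gn t t01) => yt; have -> : n = n / 2 + n / 2 by lra.
by apply: (@close_trans _ _ _ (g y)); [apply: H | apply: close_le yt; lra].
Qed.

Lemma fin_uniform (I : finType) (P : I -> R -> Prop) :
  (forall i (d d' : R), 0 < d' <= d -> P i d -> P i d') ->
  (forall i, exists2 d : R, 0 < d & P i d) -> exists2 d : R, 0 < d & forall i, P i d.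
Proof.
move=> mono ex; suff [d d0 H] : exists2 d : R, 0 < d & forall i, i \in enum I -> P i d.
  by exists d => // i; apply: H; rewrite mem_enum.
elim: (enum I) => [|i q [d d0 H]]; first by exists 1.
have [d' d'0 H'] := ex i; exists (Num.min d d'); first by rewrite lt_min d0.
move=> j; rewrite inE => /predU1P[->|/H]; [move: H' | ]; apply: mono.
  by rewrite lt_min d0 d'0 ge_min lexx orbT.
by rewrite lt_min d0 d'0 ge_min lexx.
Qed.
End Arcs.

(** * Grid approximation of an arc *)

Lemma connect_ind (T : finType) (r : rel T) (x : T) (Q : T -> Prop) :
  Q x -> (forall a b, connect r x a -> Q a -> r a b -> Q b) ->
  forall y, connect r x y -> Q y.
Proof.
move=> Qx step y /connectP[p rp ->]; elim/last_ind: p rp => [|p b IH] //=.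
rewrite rcons_path last_rcons => /andP[rp rb].
by apply: (step (last x p)) => //; [apply/connectP; exists p | apply: IH].
Qed.

Lemma connect_cross (T : finType) (r : rel T) (x y : T) (S : T -> Prop) :
  connect r x y -> S x -> ~ S y -> exists a b, [/\ r a b, S a & ~ S b].
Proof.
move=> xy Sx nSy; apply: contrapT => no; apply: nSy; move: y xy.
apply: connect_ind => // a b _ Sa ab; apply: contrapT => Sb.
by apply: no; exists a, b.
Qed.

Section GridAdj.
Variable M : nat.
Notation GV := (grid_vertex M).

Definition grid_adj : rel GV := fun a b => [exists e : grid_edge M,
  ((grid_src e == a) && (grid_tgt e == b)) || ((grid_src e == b) && (grid_tgt e == a))].

Definition grid_within (N : pred GV) : rel GV :=
  fun a b => [&& grid_adj a b, N a & N b].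

Lemma grid_adj_sym : symmetric grid_adj.
Proof. by move=> a b; apply: eq_existsb => e; rewrite orbC. Qed.

Lemma grid_within_sym N : connect_sym (grid_within N).
Proof.
apply: sym_connect_sym => a b; rewrite /grid_within grid_adj_sym.
by case: (grid_adj b a); rewrite //= andbC.
Qed.

Lemma row_connect (N : pred GV) (i i' j : 'I_M.+1) : (i <= i')%N ->
  (forall k : 'I_M.+1, (i <= k <= i')%N -> N (k, j)) ->
  connect (grid_within N) (i, j) (i', j).
Proof.
case: i' => n; elim: n => [|n IH] hn le Nk.
  by have -> : i = Ordinal hn; [apply/val_inj/eqP; rewrite -leqn0|].
have [lt|eqi] := ltnP i n.+1; last first.
  by have -> : i = Ordinal hn; [apply/val_inj/eqP; rewrite eqn_leq le|].
apply: (@connect_trans _ _ (Ordinal (ltnW hn), j)).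
  by apply: IH => // k /andP[ik kn]; apply: Nk; rewrite ik ltnW.
have hM : (n < M)%N by [].
apply/connect1/and3P; split; [|by apply: Nk => /=; lia|by apply: Nk => /=; lia].
apply/existsP; exists (inl (Ordinal hM, j)); apply/orP; left.
apply/andP; split; apply/eqP; congr pair; apply: val_inj => //=.
by rewrite /bump leqNgt hM.
Qed.

Lemma col_connect (N : pred GV) (i j j' : 'I_M.+1) : (j <= j')%N ->
  (forall k : 'I_M.+1, (j <= k <= j')%N -> N (i, k)) ->
  connect (grid_within N) (i, j) (i, j').
Proof.
case: j' => n; elim: n => [|n IH] hn le Nk.
  by have -> : j = Ordinal hn; [apply/val_inj/eqP; rewrite -leqn0|].
have [lt|eqi] := ltnP j n.+1; last first.
  by have -> : j = Ordinal hn; [apply/val_inj/eqP; rewrite eqn_leq le|].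
apply: (@connect_trans _ _ (i, Ordinal (ltnW hn))).
  by apply: IH => // k /andP[ik kn]; apply: Nk; rewrite ik ltnW.
have hM : (n < M)%N by [].
apply/connect1/and3P; split; [|by apply: Nk => /=; lia|by apply: Nk => /=; lia].
apply/existsP; exists (inr (i, Ordinal hM)); apply/orP; left.
apply/andP; split; apply/eqP; congr pair; apply: val_inj => //=.
by rewrite /bump leqNgt hM.
Qed.

Variables (R : realType) (h b : R).
Hypotheses (h0 : 0 < h) (b0 : 0 < b) (hM : (b + b) / h < M.+1%:R).

Definition grid_coord (i : nat) : R := i%:R * h - b.
Definition grid_point (q : GV) : R * R := (grid_coord q.1, grid_coord q.2).
Definition grid_round (p : R * R) : GV :=
  (inord (Num.truncn ((p.1 + b) / h)), inord (Num.truncn ((p.2 + b) / h))).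

Lemma grid_coord_mono i j : (i <= j)%N -> grid_coord i <= grid_coord j.
Proof. by move=> ij; rewrite lerD2r ler_pM2r // ler_nat. Qed.

(** A ball of [close] is a square, so moving along a row and then along a column stays inside it. *)
Lemma box_connect (p : R * R) (d : R) (N : pred GV) q q' :
  (forall u, close d (grid_point u) p -> N u) ->
  close d (grid_point q) p -> close d (grid_point q') p ->
  connect (grid_within N) q q'.
Proof.
case: q q' => [i j] [i' j'] Nd cq cq'.
have conv (k k1 k2 : 'I_M.+1) x : (k1 <= k <= k2)%N ->
    `|grid_coord k1 - x| < d -> `|grid_coord k2 - x| < d -> `|grid_coord k - x| < d.
  move=> /andP[/grid_coord_mono m1 /grid_coord_mono m2].
  rewrite !ltr_distl => /andP[? ?] /andP[? ?]; apply/andP; split; lra.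
move: cq cq' => /andP[/= c1 c2] /andP[/= c1' c2'].
apply: (@connect_trans _ _ (i', j)).
  have [le|/ltnW le] := leqP i i'; last rewrite grid_within_sym;
    by apply: row_connect => // k kk; apply: Nd; rewrite /close /= c2 andbT (conv _ _ _ _ kk).
have [le|/ltnW le] := leqP j j'; last rewrite grid_within_sym;
  by apply: col_connect => // k kk; apply: Nd; rewrite /close /= c1' (conv _ _ _ _ kk).
Qed.

Lemma grid_roundP p : close b 0 p -> close h (grid_point (grid_round p)) p.
Proof.
have aux x : `|0 - x| < b ->
    `|grid_coord (inord (Num.truncn ((x + b) / h)) : 'I_M.+1) - x| < h.
  rewrite sub0r normrN ltr_norml => /andP[lo hi].
  have x0 : 0 <= (x + b) / h by rewrite divr_ge0 ?ltW //; lra.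
  have /andP[t1 t2] := truncn_itv x0.
  have tM : (Num.truncn ((x + b) / h) < M.+1)%N.
    rewrite -(ltr_nat R); apply: le_lt_trans t1 (lt_trans _ hM).
    by rewrite ltr_pM2r ?invr_gt0 //; lra.
  rewrite inordK // /grid_coord ltr_distl.
  rewrite ler_pdivlMr // in t1; rewrite ltr_pdivrMr // -natr1 mulrDl mul1r in t2.
  by apply/andP; split; lra.
by case: p => x y /andP[/= cx cy]; rewrite /close /= !aux.
Qed.

Definition near_arc (g : R -> R * R) (q : GV) : bool :=
  `[< exists2 t : R, 0 <= t <= 1 & close (2 * h) (grid_point q) (g t) >].

(** Parameters less than [d] apart have images within [h]. Rounding costs another [h], so both
    rounded points lie in the box of radius [2 * h] used by [near_arc]. *)
Lemma arc_connect (g : R -> R * R) :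
  {within `[0, 1], continuous g}%classic ->
  (forall t : R, 0 <= t <= 1 -> close b 0 (g t)) ->
  forall t : R, 0 <= t <= 1 ->
    connect (grid_within (near_arc g)) (grid_round (g 0)) (grid_round (g t)).
Proof.
move=> gc gb; have [d d0 gd] := arc_unif gc h0.
have step (s t : R) : 0 <= s <= 1 -> 0 <= t <= 1 -> `|s - t| < d ->
    connect (grid_within (near_arc g)) (grid_round (g s)) (grid_round (g t)).
  move=> s01 t01 st; apply: (@box_connect (g t) (2 * h)).
  - by move=> u cu; apply/asboolP; exists t.
  - have -> : 2 * h = h + h by lra.
    by apply: (@close_trans _ _ _ _ (g s)); [apply/grid_roundP/gb | apply: gd].
  - have h2 : h <= 2 * h by move: h0; lra.
    exact: close_le h2 (grid_roundP (gb t t01)).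
(* The parameter advances by [d / 2], strictly below the modulus [d]. *)
have main (n : nat) (t : R) : 0 <= t <= 1 -> t <= n%:R * (d / 2) ->
    connect (grid_within (near_arc g)) (grid_round (g 0)) (grid_round (g t)).
  elim: n t => [|n IH] t t01 tn.
    have -> : t = 0 by lra.
    exact: connect0.
  have [td|td] := ltP t d.
    apply: step => //; first by rewrite lexx ler01.
    by rewrite sub0r normrN ger0_norm //; lra.
  have s01 : 0 <= t - d / 2 <= 1 by lra.
  apply: (@connect_trans _ _ (grid_round (g (t - d / 2)))).
    by apply: IH => //; rewrite -natr1 in tn; lra.
  by apply: step => //; rewrite ltr_distl; lra.
move=> t t01; apply: (main (Num.truncn (2 / d)).+1) => //.
have d2 : 0 <= 2 / d by rewrite divr_ge0 // ltW.
have /andP[_ lt] := truncn_itv d2.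
rewrite ltr_pdivrMr // in lt; lra.
Qed.
End GridAdj.

(** * Grid approximation of a plane graph *)

Section Drawing.
Variables (R : realType) (G : plane_graph R).
Notation pv := (@vertex_point R G).
Notation arc := (@edge_arc R G).

(** * Separation constants of the drawing *)

Lemma arc_continuous E : E \in edges G -> {within `[0, 1], continuous (arc E)}%classic.
Proof. by move=> /edge_arc_simple[]. Qed.

Lemma segment_cases (t : R) : 0 <= t <= 1 -> [\/ t = 0, t = 1 | 0 < t < 1].
Proof.
move=> /andP[t0 t1]; have [->|n0] := eqVneq t 0; first by constructor 1.
have [->|n1] := eqVneq t 1; first by constructor 2.
by constructor 3; rewrite lt_neqAle eq_sym n0 t0 lt_neqAle n1.
Qed.

Lemma arc_vertex E (t : R) w : E \in edges G -> 0 <= t <= 1 ->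
  pv w = arc E t -> w \in E.
Proof.
move=> EG t01; have [x [y [Exy a0 a1]]] := edge_arc_ends EG.
case: (segment_cases t01) => [->|->|t01' eq].
- by rewrite a0 Exy => /vertex_point_inj ->; rewrite !inE eqxx.
- by rewrite a1 Exy => /vertex_point_inj ->; rewrite !inE eqxx orbT.
by have := edge_arc_vertex EG t01' (esym eq).
Qed.

Lemma vertex_radius : exists2 e : R, 0 < e &
  (forall u v, close e (pv u) (pv v) -> u = v) /\
  (forall E w (t : R), E \in edges G -> 0 <= t <= 1 ->
    close e (pv w) (arc E t) -> w \in E).
Proof.
have [||d d0 Hd] := @fin_uniform R (G * G)%type (fun c d => close d (pv c.1) (pv c.2) -> c.1 = c.2).
- by move=> c d d' /andP[_ dd] H /(close_le dd).
- move=> [u v] /=; have [->|uv] := eqVneq u v; first by exists 1.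
  have [|d d0 nc] := @not_close R (pv u) (pv v).
    by move=> /vertex_point_inj uv'; rewrite uv' eqxx in uv.
  by exists d => //; rewrite (negPf nc).
have [||d' d'0 Hd'] := @fin_uniform R ({set G} * G)%type (fun c d =>
    forall t : R, c.1 \in edges G -> 0 <= t <= 1 -> close d (pv c.2) (arc c.1 t) -> c.2 \in c.1).
- by move=> c d1 d2 /andP[_ dd] H t cG t01 /(close_le dd); apply: H.
- move=> [E w] /=; have [wE|wE] := boolP (w \in E); first by exists 1.
  have [EG|EG] := boolP (E \in edges G); last by exists 1.
  have [|e e0 H] := @arc_avoid R (arc E) (pv w) (arc_continuous EG).
    by move=> t t01 /(arc_vertex EG t01); rewrite (negPf wE).
  by exists e => // t _ t01; rewrite (negPf (H t t01)).
exists (Num.min d d'); first by rewrite lt_min d0.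
split=> [u v uv|E w t EG t01 c].
  by apply: (Hd (u, v)); apply: close_le uv; rewrite ge_min lexx.
by apply: (Hd' (E, w) t EG t01); apply: close_le c; rewrite ge_min lexx orbT.
Qed.

(** Distinct edges can meet only at vertex points, so [arcs_apart] applies with these as [K];
    finiteness gives a common [d]. *)
Lemma arcs_separated (e : R) : 0 < e -> exists2 d : R, 0 < d &
  forall E F (s t : R), E \in edges G -> F \in edges G -> 0 <= s <= 1 -> 0 <= t <= 1 ->
    (forall v, ~~ close e (pv v) (arc E s)) -> close d (arc E s) (arc F t) -> E = F.
Proof.
move=> e0.
have [||d d0 Hd] := @fin_uniform R ({set G} * {set G})%type (fun c d =>
  forall s t : R, c.1 \in edges G -> c.2 \in edges G -> 0 <= s <= 1 -> 0 <= t <= 1 ->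
    (forall v, ~~ close e (pv v) (arc c.1 s)) -> close d (arc c.1 s) (arc c.2 t) ->
    c.1 = c.2); last by exists d => // E F s t; apply: (Hd (E, F)).
  move=> c d1 d2 /andP[_ dd] H s t cE cF s01 t01 av /(close_le dd).
  exact: H.
move=> [E F] /=; have [->|EF] := eqVneq E F; first by exists 1.
have [EG|EG] := boolP (E \in edges G); last by exists 1.
have [FG|FG] := boolP (F \in edges G); last by exists 1.
have [|d d0 H] := @arcs_apart R (arc E) (arc F) (fun p => exists v, p = pv v) e
    (arc_continuous EG) (arc_continuous FG) e0.
  move=> s s01; have [x [y [_ a0 a1]]] := edge_arc_ends EG.
  case: (segment_cases s01) => [->|->|s01'].
  - by left; exists (arc E 0) => //; exists x.
  - by left; exists (arc E 1) => //; exists y.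
  by right=> t t01; apply: edge_arc_disjoint.
exists d => // s t _ _ s01 t01 av c; exfalso; move: c; apply/negP/H => // p [v ->].
exact: av.
Qed.

Lemma drawing_bounded : exists2 b : R, 0 < b &
  (forall v, close b 0 (pv v)) /\
  (forall E (t : R), E \in edges G -> 0 <= t <= 1 -> close b 0 (arc E t)).
Proof.
have mono (d d' : R) : 0 < d' <= d -> d^-1 <= d'^-1.
  by move=> /andP[d'0 dd]; rewrite lef_pV2 // posrE (lt_le_trans d'0).
have [||d d0 Hd] := @fin_uniform R G (fun v d => close d^-1 0 (pv v)).
- by move=> v d d' /mono dd; apply: close_le.
- move=> v; exists (`|(pv v).1| + `|(pv v).2| + 1)^-1.
    by rewrite invr_gt0 ltr_wpDl // addr_ge0.
  rewrite invrK /close !sub0r !normrN; have := normr_ge0 (pv v).1.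
  by have := normr_ge0 (pv v).2 => ? ?; apply/andP; split; lra.
have [||d' d'0 Hd'] := @fin_uniform R {set G} (fun E d =>
    forall t : R, E \in edges G -> 0 <= t <= 1 -> close d^-1 0 (arc E t)).
- by move=> E d1 d2 /mono dd H t EG t01; apply: close_le (H t EG t01).
- move=> E; have [EG|EG] := boolP (E \in edges G); last by exists 1.
  have [b b0 Hb] := arc_bounded (arc_continuous EG).
  by exists b^-1; rewrite ?invr_gt0 // => t _ t01; rewrite invrK; apply: Hb.
have m0 : 0 < Num.min d d' by rewrite lt_min d0.
exists (Num.min d d')^-1; first by rewrite invr_gt0.
split=> [v|E t EG t01]; [apply: close_le (Hd v) | apply: close_le (Hd' E t EG t01)];
  by apply: mono; rewrite m0 ge_min lexx ?orbT.
Qed.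

(** * Branch sets in the grid *)

Section Labelling.
Variables (M : nat) (e h b : R).
(** Boxes have radius [e]. Two points near one grid point are within [4 * h] of each other. An arc
    point within [e / 2] of a vertex has its nearby grid points in the box, as
    [2 * h + e / 2 <= e]. *)
Hypotheses (h0 : 0 < h) (b0 : 0 < b) (hM : (b + b) / h < M.+1%:R) (he : 4 * h <= e).
Hypothesis vertex_sep : forall u v, close (e + e) (pv u) (pv v) -> u = v.
Hypothesis edge_sep : forall E w (t : R), E \in edges G -> 0 <= t <= 1 ->
  close (e + e) (pv w) (arc E t) -> w \in E.
Hypothesis arc_sep : forall E F (s t : R), E \in edges G -> F \in edges G ->
  0 <= s <= 1 -> 0 <= t <= 1 -> (forall v, ~~ close (e / 2) (pv v) (arc E s)) ->
  close (4 * h) (arc E s) (arc F t) -> E = F.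
Hypothesis pv_bounded : forall v, close b 0 (pv v).
Hypothesis arc_bounded : forall E (t : R), E \in edges G -> 0 <= t <= 1 ->
  close b 0 (arc E t).

Notation GV := (grid_vertex M).
Local Notation pt := (@grid_point M R h b).
Local Notation rd := (@grid_round M R h b).
Local Notation near E := (@near_arc M R h b (arc E)).

Definition vertex_box v : pred GV := fun q => close e (pt q) (pv v).

Definition half_edge E v w := [/\ E \in edges G, E = [set v; w]%SET,
  arc E 0 = pv v & arc E 1 = pv w].

Definition before E w : pred GV := fun q => near E q && ~~ vertex_box w q.

(* The branch set of [v] consists of the grid box around [v] and, for each edge
   oriented from [v] to [w], of the part of the grid path along that edge that
   precedes the box around [w]. *)
Definition in_branch v (q : GV) := vertex_box v q \/
  exists E w, half_edge E v w /\ connect (grid_within (before E w)) (rd (pv v)) q.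

Let e0 : 0 < e. Proof. by move: h0 he; lra. Qed.

Let center_box v : vertex_box v (rd (pv v)).
Proof. by apply: (@close_le _ h); [move: h0 he; lra | apply: grid_roundP]. Qed.

Let box_uniq u v q : vertex_box u q -> vertex_box v q -> u = v.
Proof.
by move=> bu bv; apply: vertex_sep; apply: close_trans bv; rewrite closeC.
Qed.

Let half_edge_neq E v w : half_edge E v w -> v != w.
Proof.
case=> /edgesP[x [y [xy ->]]] eq _ _; apply: contraTneq xy => vw; subst w.
move/finset.setP: eq => eq; have := eq x; have := eq y; rewrite !inE !eqxx orbT !orbb /=.
by move=> /esym/eqP -> /esym/eqP ->; rewrite adj_irr.
Qed.

Let near_box E w q : E \in edges G -> near E q -> vertex_box w q -> w \in E.
Proof.
move=> EG /asboolP[t t01 c] bw; apply: (edge_sep EG t01).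
apply: (@close_le _ (e + 2 * h)); first by move: h0 he; lra.
by apply: close_trans c; rewrite closeC.
Qed.

Let before_center E v w : half_edge E v w -> before E w (rd (pv v)).
Proof.
move=> H; have [EG _ a0 _] := H; apply/andP; split.
  apply/asboolP; exists 0; first by rewrite lexx ler01.
  by rewrite a0; apply: (@close_le _ h); [move: h0; lra | apply: grid_roundP].
apply: contra (half_edge_neq H) => bw; apply/eqP.
exact: box_uniq (center_box v) bw.
Qed.

Let reach_before E v w q : half_edge E v w ->
  connect (grid_within (before E w)) (rd (pv v)) q -> before E w q.
Proof.
move=> H; move: q; apply: connect_ind; first exact: before_center.
by move=> a c _ _ /and3P[].
Qed.

(** Boxes are disjoint, and a path part meets no box but that of its tail. Path parts meeting
    outside all boxes follow the same edge by [arc_sep], and its orientation fixes the tail. *)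
Let branch_uniq u v q : in_branch u q -> in_branch v q -> u = v.
Proof.
have box_branch u' v' : vertex_box u' q -> in_branch v' q -> u' = v'.
  move=> bu [bv|[E [w [H c]]]]; first exact: box_uniq bu bv.
  have /andP[nE nw] := reach_before H c; have [EG Evw _ _] := H.
  have := near_box EG nE bu; rewrite Evw !inE => /orP[] /eqP // uw.
  by rewrite -uw bu in nw.
move=> Bu Bv; have [[x bx]|no] := pselect (exists x, vertex_box x q).
  by rewrite -(box_branch _ _ bx Bu) -(box_branch _ _ bx Bv).
case: Bu => [bu|[E [w [H c]]]]; first by case: no; exists u.
case: Bv => [bv|[E' [w' [H' c']]]]; first by case: no; exists v.
have /andP[/asboolP[s s01 cs] _] := reach_before H c.
have /andP[/asboolP[t t01 ct] _] := reach_before H' c'.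
have [EG _ a0 _] := H; have [EG' _ a0' _] := H'.
have EE : E = E'.
  apply: (arc_sep EG EG' s01 t01) => [x|].
    apply/negP => cx; apply: no; exists x.
    apply: (@close_le _ (2 * h + e / 2)); first by move: h0 he; lra.
    by apply: close_trans cs _; rewrite closeC.
  have -> : 4 * h = 2 * h + 2 * h by lra.
  by apply: close_trans ct; rewrite closeC.
by apply: (@vertex_point_inj R G); rewrite -a0 -a0' EE.
Qed.

Definition label (q : GV) : option G := [pick v | `[< in_branch v q >]].

Let labelP v q : label q = Some v <-> in_branch v q.
Proof.
rewrite /label; case: pickP => [u /asboolP Bu|no]; split.
- by case=> <-.
- by move=> Bv; rewrite (branch_uniq Bu Bv).
- by [].
- by move=> Bv; have /negP[] := negbT (no v); apply/asboolP.
Qed.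

Let center_branch v : in_branch v (rd (pv v)).
Proof. by left; apply: center_box. Qed.

Lemma label_surj v : exists q, label q = Some v.
Proof. by exists (rd (pv v)); apply/labelP/center_branch. Qed.

(** Every point of a branch set is joined inside it to the rounded position of its vertex. *)
Lemma label_conn (P : GV -> bool) :
  (forall d, label (grid_src d) -> label (grid_src d) = label (grid_tgt d) ->
    P (grid_src d) = P (grid_tgt d)) ->
  forall x y, label x -> label x = label y -> P x = P y.
Proof.
move=> Pd; have Padj v a c : grid_adj a c -> in_branch v a -> in_branch v c -> P a = P c.
  move=> /existsP[d /orP[] /andP[/eqP <- /eqP <-]] /labelP la /labelP lc;
    first by apply: Pd; rewrite ?la ?lc.
  by apply/esym/Pd; rewrite ?la ?lc.
have Pc v q : in_branch v q -> P q = P (rd (pv v)).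
  case=> [bq|[E [w [H]]]].
    have : connect (grid_within (vertex_box v)) (rd (pv v)) q.
      by apply: (@box_connect M R h b h0 (pv v) e) => //; apply: center_box.
    move: q {bq}; apply: connect_ind => // a c _ <- /and3P[ac ba bc].
    by apply/esym/(Padj v) => //; left.
  move: q; apply: connect_ind => // a c ca <- ac.
  apply/esym/(Padj v); first by case/and3P: ac.
    by right; exists E, w.
  by right; exists E, w; split=> //; apply: connect_trans ca (connect1 ac).
move=> x y; case lx: (label x) => [v|//] _ /esym ly.
by rewrite (Pc v x) ?(Pc v y) //; apply/labelP.
Qed.

(** The grid path along the arc starts in the branch set of the tail [v] and ends in the box of [w].
    The step at which it leaves the component of [before E w] containing its start must enter that
    box. *)
Lemma label_edge x y : adj x y -> exists d : grid_edge M,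
  (label (grid_src d) = Some x /\ label (grid_tgt d) = Some y) \/
  (label (grid_src d) = Some y /\ label (grid_tgt d) = Some x).
Proof.
move=> xy; have EG : [set x; y]%SET \in edges G by apply/edgesP; exists x, y.
have [v [w [Evw a0 a1]]] := edge_arc_ends EG.
set E := [set x; y]%SET in EG Evw a0 a1.
have H : half_edge E v w by [].
(* The arc may run from [y] to [x]; the conclusion is symmetric in the two ends. *)
suff [d dP] : exists d : grid_edge M,
    (label (grid_src d) = Some v /\ label (grid_tgt d) = Some w) \/
    (label (grid_src d) = Some w /\ label (grid_tgt d) = Some v).
  have vw := half_edge_neq H; move/finset.setP: (Evw) => eq.
  have := eq v; have := eq w.
  rewrite !inE !eqxx orbT /= => /orP[] /eqP wE /orP[] /eqP vE; subst.
  - by rewrite eqxx in vw.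
  - by exists d; case: dP; [right | left].
  - by exists d.
  - by rewrite eqxx in vw.
have l01 : 0 <= (1 : R) <= 1 by apply/andP; split.
have := @arc_connect M R h b h0 hM (arc E) (arc_continuous EG) _ 1 l01.
rewrite a0 a1 => /(_ (fun t => arc_bounded EG)) vw.
have [||a [c [/and3P[ac _ nc] ca nca]]] := connect_cross
    (S := fun q => connect (grid_within (before E w)) (rd (pv v)) q) vw.
- exact: connect0.
- by move=> /(reach_before H)/andP[_]; rewrite center_box.
have la : label a = Some v by apply/labelP; right; exists E, w.
have lc : label c = Some w.
  apply/labelP; left; apply: contrapT => /negP bc; apply: nca.
  have ba := reach_before H ca; apply: (connect_trans ca); apply: connect1.
  rewrite /grid_within ac ba.
  by rewrite /before nc bc.
case/existsP: ac => d /orP[] /andP[/eqP sd /eqP td]; exists d; rewrite sd td; by [left|right].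
Qed.
End Labelling.

Lemma drawing_bound : ~ contains G K4 -> ~ contains G Theta5 -> (5 < #|G|)%N ->
  (11 * #|edges G| + 50 <= 25 * #|G|)%N.
Proof.
move=> K4G Th5G G6.
have [r r0 [vsep esep]] := vertex_radius.
(* Halving leaves room for the radius [e + e] in the separation hypotheses. *)
pose e := r / 2; have e0 : 0 < e by rewrite divr_gt0.
have ee : e + e = r by rewrite /e; lra.
have e2 : 0 < e / 2 by rewrite divr_gt0.
have [d d0 asep] := arcs_separated e2.
have [b b0 [pb ab]] := drawing_bounded.
pose h := Num.min e d / 4; have m0 : 0 < Num.min e d by rewrite lt_min e0.
have h0 : 0 < h by rewrite divr_gt0.
have h4 : 4 * h = Num.min e d by rewrite /h; lra.
have he : 4 * h <= e by rewrite h4 ge_min lexx.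
have hd : 4 * h <= d by rewrite h4 ge_min lexx orbT.
(* With this [M] the grid of mesh [h], starting at [-b], covers the square of half-side [b] around
   the origin up to rounding. *)
pose M := Num.truncn ((b + b) / h).
have hM : (b + b) / h < M.+1%:R.
  have bh : 0 <= (b + b) / h by rewrite divr_ge0 ?addr_ge0 ?ltW.
  by have /andP[] := truncn_itv bh.
rewrite -ee in vsep esep.
have asep' E F (s t : R) : E \in edges G -> F \in edges G -> 0 <= s <= 1 ->
    0 <= t <= 1 -> (forall v, ~~ close (e / 2) (pv v) (arc E s)) ->
    close (4 * h) (arc E s) (arc F t) -> E = F.
  by move=> EG FG s01 t01 av /(close_le hd); apply: asep.
apply: (@grid_minor_bound G M (@label M e h b)) => //.
- exact: label_surj.
- exact: label_conn.
- exact: label_edge.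
Qed.
End Drawing.

Theorem theorem1p7 (R : realType) (n : nat) (G : plane_graph R)
    (hn : (25 <= n)%N) (hG : #|G| = n)
    (hK4 : ~ contains G K4) (hTheta5 : ~ contains G Theta5) :
  #|edges G|%:R <= (25%:R / 11%:R) * (n%:R - 2%:R) :> rat.
Proof.
have G6 : (5 < #|G|)%N by rewrite hG; apply: leq_trans hn.
have := drawing_bound hK4 hTheta5 G6; rewrite hG -(ler_nat rat) natrD !natrM; lra.
Qed.
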